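(* Let $k\ge 3$ be an integer. There are homeomorphisms $$\widetilde{\mathcal{P}}_{k}(\mathbb{R}^{2})\simeq \widetilde{Gr}_{\mathbb{R}}(2,k)/O(1)^{k},\qquad \widetilde{\mathcal{P}}_{k}(\mathbb{R}^{3})\simeq SU(2)\backslash V_{\mathbb{C}}(2,k)/U(1)^{k},\qquad \widetilde{\mathcal{P}}_{k}(\mathbb{R}^{5})\simeq Gr_{\mathbb{H}}(2,k)/\mathbb{H}(1)^{k}.$$
   Context: Polygon spaces: for a finite-dimensional Euclidean space $V$, $\mathcal{M}_k(V)$ is the space of closed $k$-gons of perimeter $1$, i.e. $\mathcal{M}_k(V)=\{p=(p(1),\dots,p(k))\in V^k : \sum_{i}p(i)=0,\ \sum_i |p(i)|=1\}$ with the subspace topology (some, but not all, of the $p(i)$ may be zero). The group $SO(V)$ acts by $(g\cdot p)(i)=g(p(i))$, and $\widetilde{\mathcal{P}}_k(V):=SO(V)\backslash \mathcal{M}_k(V)$ with the quotient topology. Stiefel manifolds: for $\mathbb{F}=\mathbb{R},\mathbb{C},\mathbb{H}$, $V_{\mathbb{F}}(2,k)=\{X\in \mathrm{Mat}_{2\times k}(\mathbb{F}) : XX^{*}=I_2\}$, where $X^*$ is the conjugate transpose. The groups $SO(2)$, $SU(2)$, $Sp(2)$ (for $\mathbb{F}=\mathbb{R},\mathbb{C},\mathbb{H}$ respectively) act on $V_{\mathbb{F}}(2,k)$ by left matrix multiplication. Let $\mathbb{F}(1)=\{c\in\mathbb{F}:|c|=1\}$, so $\mathbb{R}(1)=O(1)$,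 $\mathbb{C}(1)=U(1)$, $\mathbb{H}(1)=Sp(1)$. The group $\mathbb{F}(1)^k$ acts on $V_{\mathbb{F}}(2,k)$ on the right: $(c_1,\dots,c_k)$ multiplies both entries of the $i$-th column on the right by $c_i$. The left and right actions commute. The oriented real Grassmannian is $\widetilde{Gr}_{\mathbb{R}}(2,k)=SO(2)\backslash V_{\mathbb{R}}(2,k)$ and the quaternionic Grassmannian is $Gr_{\mathbb{H}}(2,k)=Sp(2)\backslash V_{\mathbb{H}}(2,k)$; the actions of $O(1)^k$ and $\mathbb{H}(1)^k$ on them are those induced from the right actions above. All quotients carry the quotient topology. *)

(* Defs.v *)
From HB Require Import structures.
From mathcomp Require Import all_boot all_order all_algebra.
From mathcomp Require Import all_classical all_reals all_analysis.
From mathcomp Require Import complex ring.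
Import GRing.Theory Num.Theory.
Import numFieldNormedType.Exports.

Set Implicit Arguments.
Unset Strict Implicit.
Unset Printing Implicit Defensive.

Local Open Scope classical_set_scope.
Local Open Scope ring_scope.
Local Open Scope quotient_scope.

Definition homeomorphic (X Y : topologicalType) : Prop :=
  exists (f : X -> Y) (g : Y -> X),
    [/\ cancel f g, cancel g f, continuous f & continuous g].

Record laction (G : groupType) (T : Type) := LAction {
  lact :> G -> T -> T;
  lact1 : forall x, lact 1%g x = x;
  lactM : forall g h x, lact (g * h)%g x = lact g (lact h x) }.

Record raction (G : groupType) (T : Type) := RAction {
  ract :> T -> G -> T;
  ract1 : forall x, ract x 1%g = x;
  ractM : forall x g h, ract x (g * h)%g = ract (ract x g) h }.

Section Restriction.
Variables (G H : groupType) (f : UMagmaMorphism.type H G) (T : Type).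
Variable a : laction G T.

Fact restr_act1 x : a (f 1%g) x = x.
Proof. by rewrite gmulf1 lact1. Qed.
Fact restr_actM g h x : a (f (g * h)%g) x = a (f g) (a (f h) x).
Proof. by rewrite gmulfM lactM. Qed.

Definition restr_laction : laction H T :=
  @LAction H T (fun h => a (f h)) restr_act1 restr_actM.
End Restriction.

Section LeftOrbits.
Variables (G : groupType) (T : topologicalType) (a : laction G T).

Definition lorbit_rel : rel T := fun x y => `[< exists g, a g x = y >].

Fact lorbit_refl : reflexive lorbit_rel.
Proof. by move=> x; apply/asboolP; exists 1%g; rewrite lact1. Qed.
Fact lorbit_sym : symmetric lorbit_rel.
Proof.
suff h x y : lorbit_rel x y -> lorbit_rel y x.
  by move=> x y; apply/idP/idP; exact: h.
by move=> /asboolP[g <-]; apply/asboolP; exists g^-1%g; rewrite -lactM mulVg lact1.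
Qed.
Fact lorbit_trans : transitive lorbit_rel.
Proof.
move=> y x z /asboolP[g <-] /asboolP[h <-].
by apply/asboolP; exists (h * g)%g; rewrite lactM.
Qed.

Canonical lorbit_equiv := EquivRel lorbit_rel lorbit_refl lorbit_sym lorbit_trans.

Definition lorbits : topologicalType := quotient_topology {eq_quot lorbit_equiv}.

Definition lorbit (x : T) : lorbits := \pi_({eq_quot lorbit_equiv}) x.

Lemma lorbitP x y : lorbit x = lorbit y <-> exists g, a g x = y.
Proof.
split; first by move=> /eqmodP/asboolP.
by move=> e; apply/eqmodP/asboolP.
Qed.

Lemma lorbit_repr (q : lorbits) : lorbit (repr (q : {eq_quot lorbit_equiv})) = q.
Proof. exact: reprK. Qed.
End LeftOrbits.

Section RightOrbits.
Variables (G : groupType) (T : topologicalType) (a : raction G T).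

Definition rorbit_rel : rel T := fun x y => `[< exists g, a x g = y >].

Fact rorbit_refl : reflexive rorbit_rel.
Proof. by move=> x; apply/asboolP; exists 1%g; rewrite ract1. Qed.
Fact rorbit_sym : symmetric rorbit_rel.
Proof.
suff h x y : rorbit_rel x y -> rorbit_rel y x.
  by move=> x y; apply/idP/idP; exact: h.
by move=> /asboolP[g <-]; apply/asboolP; exists g^-1%g; rewrite -ractM mulgV ract1.
Qed.
Fact rorbit_trans : transitive rorbit_rel.
Proof.
move=> y x z /asboolP[g <-] /asboolP[h <-].
by apply/asboolP; exists (g * h)%g; rewrite ractM.
Qed.

Canonical rorbit_equiv := EquivRel rorbit_rel rorbit_refl rorbit_sym rorbit_trans.

Definition rorbits : topologicalType := quotient_topology {eq_quot rorbit_equiv}.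

Definition rorbit (x : T) : rorbits := \pi_({eq_quot rorbit_equiv}) x.

Lemma rorbitP x y : rorbit x = rorbit y <-> exists g, a x g = y.
Proof.
split; first by move=> /eqmodP/asboolP.
by move=> e; apply/eqmodP/asboolP.
Qed.
End RightOrbits.

Section InducedAction.
Variables (G H : groupType) (T : topologicalType).
Variables (l : laction G T) (r : raction H T).
Hypothesis lrC : forall g x h, r (l g x) h = l g (r x h).

Definition induced_ract (q : lorbits l) (h : H) : lorbits l :=
  lorbit l (r (repr (q : {eq_quot lorbit_equiv l})) h).

(* The choice of a representative in [induced_ract] is immaterial. *)
Lemma induced_ractE x h : induced_ract (lorbit l x) h = lorbit l (r x h).
Proof.
have /lorbitP[g e] := lorbit_repr (lorbit l x).
by apply/lorbitP; exists g; rewrite -lrC e.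
Qed.

Fact induced_ract1 q : induced_ract q 1%g = q.
Proof. by rewrite -(lorbit_repr q) induced_ractE ract1. Qed.
Fact induced_ractM q g h :
  induced_ract q (g * h)%g = induced_ract (induced_ract q g) h.
Proof. by rewrite -(lorbit_repr q) !induced_ractE ractM. Qed.

Definition induced_raction : raction H (lorbits l) :=
  RAction induced_ract1 induced_ractM.
End InducedAction.

(* Conjugation [cj] and absolute value [nm] on F = R, C or H; the absolute
   value is used only to single out the elements of F(1). *)
Record conj_norm (R : realType) (F : nzRingType) := ConjNorm {
  cj : F -> F;
  nm : F -> R;
  cjD : forall x y, cj (x + y) = cj x + cj y;
  cjM : forall x y, cj (x * y) = cj y * cj x;
  cjK : involutive cj;
  cj_normal : forall x, cj x * x = x * cj x;
  nm_eq1 : forall x, nm x = 1 <-> x * cj x = 1 }.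

Section ConjNormTheory.
Variables (R : realType) (F : nzRingType) (S : conj_norm R F).

Lemma cj0 : cj S 0 = 0.
Proof. by apply: (addrI (cj S 0)); rewrite -cjD !addr0. Qed.

Lemma cj1 : cj S 1 = 1.
Proof. by rewrite -[RHS](cjK S 1) -[X in _ = cj S X]mulr1 cjM cjK mulr1. Qed.

Lemma cj_sum I (s : seq I) (P : pred I) (E : I -> F) :
  cj S (\sum_(i <- s | P i) E i) = \sum_(i <- s | P i) cj S (E i).
Proof. exact: (big_morph _ (cjD S) cj0). Qed.

Definition adjmx m n (A : 'M[F]_(m, n)) : 'M[F]_(n, m) :=
  \matrix_(i, j) cj S (A j i).

Lemma adjmxM m n p (A : 'M[F]_(m, n)) (B : 'M[F]_(n, p)) :
  adjmx (A *m B) = adjmx B *m adjmx A.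
Proof.
apply/matrixP => i j; rewrite !mxE cj_sum; apply: eq_bigr => l _.
by rewrite !mxE cjM.
Qed.

Lemma adjmxK m n (A : 'M[F]_(m, n)) : adjmx (adjmx A) = A.
Proof. by apply/matrixP => i j; rewrite !mxE cjK. Qed.

Lemma adjmx1 n : adjmx (1%:M : 'M[F]_n) = 1%:M.
Proof.
apply/matrixP => i j; rewrite !mxE eq_sym.
by case: (i == j); rewrite ?cj1 ?cj0.
Qed.

(* F(1) *)
Definition unit_sphere : Type := set_type [set c : F | nm S c = 1].
HB.instance Definition _ := SubChoice.on unit_sphere.

Lemma unit_sphereP (c : unit_sphere) : val c * cj S (val c) = 1.
Proof. by apply/(nm_eq1 S)/(set_mem (valP c)). Qed.

Fact unit_sphere_one_mem : (1 : F) \in [set c : F | nm S c = 1].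
Proof. by apply/mem_set/nm_eq1; rewrite cj1 mulr1. Qed.
Fact unit_sphere_mul_mem (c d : unit_sphere) :
  val c * val d \in [set c : F | nm S c = 1].
Proof.
apply/mem_set/nm_eq1; rewrite cjM mulrA -(mulrA (val c)) unit_sphereP mulr1.
exact: unit_sphereP.
Qed.
Fact unit_sphere_inv_mem (c : unit_sphere) :
  cj S (val c) \in [set c : F | nm S c = 1].
Proof. by apply/mem_set/nm_eq1; rewrite cjK cj_normal unit_sphereP. Qed.

Definition unit_sphere_one : unit_sphere := Sub 1 unit_sphere_one_mem.
Definition unit_sphere_mul (c d : unit_sphere) : unit_sphere :=
  Sub (val c * val d) (unit_sphere_mul_mem c d).
Definition unit_sphere_inv (c : unit_sphere) : unit_sphere :=
  Sub (cj S (val c)) (unit_sphere_inv_mem c).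

Fact unit_sphere_mulA : associative unit_sphere_mul.
Proof. by move=> c d e; apply: val_inj; rewrite !SubK mulrA. Qed.
Fact unit_sphere_mul1l : left_id unit_sphere_one unit_sphere_mul.
Proof. by move=> c; apply: val_inj; rewrite !SubK mul1r. Qed.
Fact unit_sphere_mul1r : right_id unit_sphere_one unit_sphere_mul.
Proof. by move=> c; apply: val_inj; rewrite !SubK mulr1. Qed.
Fact unit_sphere_mulVl :
  left_inverse unit_sphere_one unit_sphere_inv unit_sphere_mul.
Proof. by move=> c; apply: val_inj; rewrite !SubK cj_normal unit_sphereP. Qed.
Fact unit_sphere_mulVr :
  right_inverse unit_sphere_one unit_sphere_inv unit_sphere_mul.
Proof. by move=> c; apply: val_inj; rewrite !SubK unit_sphereP. Qed.

HB.instance Definition _ := isGroup.Build unit_sphere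
  unit_sphere_mulA unit_sphere_mul1l unit_sphere_mul1r
  unit_sphere_mulVl unit_sphere_mulVr.

Lemma val_unit_sphere1 : val (1%g : unit_sphere) = 1.
Proof. exact: SubK. Qed.
Lemma val_unit_sphereM (c d : unit_sphere) : val (c * d)%g = val c * val d.
Proof. exact: SubK. Qed.

Section UnitaryGroup.
Variable n : nat.

(* O(n), U(n) or Sp(n): the matrices whose inverse is their conjugate
   transpose. Over a general noncommutative F one equation does not imply the
   other, whence the conjunction. *)
Definition unitary_set : set 'M[F]_n :=
  [set A | A *m adjmx A = 1%:M /\ adjmx A *m A = 1%:M].

Definition unitary : Type := set_type unitary_set.
HB.instance Definition _ := SubChoice.on unitary.

Lemma unitaryP (A : unitary) : unitary_set (val A).
Proof. exact: set_mem (valP A). Qed.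

Fact unitary_one_mem : 1%:M \in unitary_set.
Proof. by apply/mem_set; rewrite /unitary_set /= adjmx1 mulmx1. Qed.
Fact unitary_mul_mem (A B : unitary) : val A *m val B \in unitary_set.
Proof.
have [A1 A2] := unitaryP A; have [B1 B2] := unitaryP B.
apply/mem_set; rewrite /unitary_set /= adjmxM; split.
  by rewrite mulmxA -(mulmxA (val A)) B1 mulmx1.
by rewrite mulmxA -(mulmxA (adjmx (val B))) A2 mulmx1.
Qed.
Fact unitary_inv_mem (A : unitary) : adjmx (val A) \in unitary_set.
Proof.
by have [A1 A2] := unitaryP A; apply/mem_set; rewrite /unitary_set /= adjmxK.
Qed.

Definition unitary_one : unitary := Sub 1%:M unitary_one_mem.
Definition unitary_mul (A B : unitary) : unitary :=
  Sub (val A *m val B) (unitary_mul_mem A B).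
Definition unitary_inv (A : unitary) : unitary := Sub (adjmx (val A)) (unitary_inv_mem A).

Fact unitary_mulA : associative unitary_mul.
Proof. by move=> A B C; apply: val_inj; rewrite !SubK mulmxA. Qed.
Fact unitary_mul1l : left_id unitary_one unitary_mul.
Proof. by move=> A; apply: val_inj; rewrite !SubK mul1mx. Qed.
Fact unitary_mul1r : right_id unitary_one unitary_mul.
Proof. by move=> A; apply: val_inj; rewrite !SubK mulmx1. Qed.
Fact unitary_mulVl : left_inverse unitary_one unitary_inv unitary_mul.
Proof. by move=> A; apply: val_inj; rewrite !SubK; case: (unitaryP A). Qed.
Fact unitary_mulVr : right_inverse unitary_one unitary_inv unitary_mul.
Proof. by move=> A; apply: val_inj; rewrite !SubK; case: (unitaryP A). Qed.

HB.instance Definition _ := isGroup.Build unitary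
  unitary_mulA unitary_mul1l unitary_mul1r unitary_mulVl unitary_mulVr.

Lemma val_unitary1 : val (1%g : unitary) = 1%:M.
Proof. exact: SubK. Qed.
Lemma val_unitaryM (A B : unitary) : val (A * B)%g = val A *m val B.
Proof. exact: SubK. Qed.
Lemma val_unitaryV (A : unitary) : val A^-1%g = adjmx (val A).
Proof. exact: SubK. Qed.
End UnitaryGroup.

Section Stiefel.
Variable k : nat.

Definition stiefel_set : set 'M[F]_(2, k) := [set X | X *m adjmx X = 1%:M].

Fact st_lact_mem (A : unitary 2) (X : stiefel_set) :
  val A *m val X \in stiefel_set.
Proof.
have [A1 _] := unitaryP A; have /= X1 := set_mem (valP X).
apply/mem_set; rewrite /stiefel_set /= adjmxM mulmxA -(mulmxA (val A)).
by rewrite [val X *m _]X1 mulmx1.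
Qed.

Definition stiefel_lact (A : unitary 2) (X : stiefel_set) : stiefel_set :=
  Sub (val A *m val X) (st_lact_mem A X).

Fact stiefel_lact1 X : stiefel_lact 1%g X = X.
Proof. by apply: val_inj; rewrite SubK val_unitary1 mul1mx. Qed.
Fact stiefel_lactM (A B : unitary 2) X :
  stiefel_lact (A * B)%g X = stiefel_lact A (stiefel_lact B X).
Proof. by apply: val_inj; rewrite !SubK mulmxA. Qed.

Definition stiefel_laction : laction (unitary 2) stiefel_set :=
  LAction stiefel_lact1 stiefel_lactM.

Definition scale_cols (X : 'M[F]_(2, k)) (c : {ffun 'I_k -> unit_sphere}) :
  'M[F]_(2, k) := \matrix_(a, i) (X a i * val (c i)).

Fact st_ract_mem (X : stiefel_set) (c : {ffun 'I_k -> unit_sphere}) :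
  scale_cols (val X) c \in stiefel_set.
Proof.
have /= X1 := set_mem (valP X); apply/mem_set; rewrite /stiefel_set /=.
apply: etrans X1; apply/matrixP => a b; rewrite !mxE; apply: eq_bigr => i _.
by rewrite !mxE cjM mulrA -(mulrA (val X a i)) unit_sphereP mulr1.
Qed.

Definition stiefel_ract (X : stiefel_set) (c : {ffun 'I_k -> unit_sphere}) :
  stiefel_set := Sub (scale_cols (val X) c) (st_ract_mem X c).

Fact stiefel_ract1 X : stiefel_ract X 1%g = X.
Proof.
apply: val_inj; rewrite SubK; apply/matrixP => a i.
by rewrite !mxE ffunE val_unit_sphere1 mulr1.
Qed.
Fact stiefel_ractM X c d :
  stiefel_ract X (c * d)%g = stiefel_ract (stiefel_ract X c) d.
Proof.
apply: val_inj; rewrite !SubK; apply/matrixP => a i.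
by rewrite !mxE ffunE val_unit_sphereM mulrA.
Qed.

Definition stiefel_raction : raction {ffun 'I_k -> unit_sphere} stiefel_set :=
  RAction stiefel_ract1 stiefel_ractM.

Lemma stiefel_actC A X c :
  stiefel_raction (stiefel_laction A X) c = stiefel_laction A (stiefel_raction X c).
Proof.
apply: val_inj; rewrite !SubK; apply/matrixP => a i.
by rewrite !mxE mulr_suml; apply: eq_bigr => b _; rewrite !mxE mulrA.
Qed.
End Stiefel.
End ConjNormTheory.
Arguments stiefel_set {R F} S k.
Arguments unitary_set {R F} S n.

Section SpecialUnitary.
Variables (R : realType) (F : comNzRingType) (S : conj_norm R F) (n : nat).

Definition special : {pred unitary S n} := fun A => \det (val A) == 1.

Fact special_group_closed : group_closed special.
Proof.
split; first by rewrite unfold_in val_unitary1 det1.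
move=> A B; rewrite !unfold_in => /eqP dA /eqP dB.
have [_ /(congr1 determinant)] := unitaryP B; rewrite det_mulmx dB mulr1 det1 => dBV.
by rewrite val_unitaryM val_unitaryV det_mulmx dA dBV mulr1.
Qed.

(* SO(n) for F = R, SU(n) for F = C *)
Definition special_unitary : Type := {A : unitary S n | special A}.
HB.instance Definition _ := SubChoice.on special_unitary.
HB.instance Definition _ :=
  SubChoice_isSubGroup.Build _ _ special_unitary special_group_closed.

Definition special_incl : UMagmaMorphism.type special_unitary (unitary S n) :=
  val.
End SpecialUnitary.

Section RealComplex.
Variable R : realType.

Fact real_abs_eq1 (x : R) : `|x| = 1 <-> x * x = 1.
Proof.
split=> [h|/eqP]; first by rewrite -expr2 -real_normK ?num_real// h expr1n.
by rewrite -expr2 -real_normK ?num_real// sqrp_eq1// => /eqP.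
Qed.

Definition real_conj_norm : conj_norm R R :=
  @ConjNorm R R id (fun x => `|x|) (fun _ _ => erefl) (@mulrC R)
    (fun _ => erefl) (fun _ => erefl) real_abs_eq1.

Fact conjcD (x y : R[i]) : conjc (x + y) = conjc x + conjc y.
Proof. exact: raddfD. Qed.
Fact conjcM (x y : R[i]) : conjc (x * y) = conjc y * conjc x.
Proof. by rewrite rmorphM mulrC. Qed.
Fact normc_eq1 (x : R[i]) : Normc.normc x = 1 <-> x * conjc x = 1.
Proof.
case: x => a b; rewrite /Normc.normc.
have -> : (a +i* b)%C * conjc (a +i* b)%C = (a ^+ 2 + b ^+ 2)%:C%C.
  by apply/eqP; rewrite eq_complex /=; apply/andP; split; apply/eqP; ring.
have s0 : 0 <= a ^+ 2 + b ^+ 2 by rewrite addr_ge0 ?sqr_ge0.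
split=> [h|[h]]; last by rewrite h sqrtr1.
by rewrite -[a ^+ 2 + b ^+ 2]sqr_sqrtr// h expr1n.
Qed.

Definition complex_conj_norm : conj_norm R R[i] :=
  @ConjNorm R R[i] conjc (@Normc.normc R) conjcD conjcM (@conjcK R)
    (fun x => mulrC _ _) normc_eq1.
End RealComplex.

(* The topology defined by the norm *)
HB.instance Definition _ (R : realType) := PseudoPointedMetric.copy R[i] R[i]^o.

(* (a, b, c, d) stands for a + b i + c j + d k; this is a fresh alias because
   the product type already carries the componentwise multiplication. *)
Definition quaternion (R : realType) : Type := (R * R * R * R)%type.

Section Quaternion.
Variable R : realType.
Local Notation H := (quaternion R).

HB.instance Definition _ := GRing.Zmodule.copy H (R * R * R * R)%type.
HB.instance Definition _ := Topological.copy H (R * R * R * R)%type.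

Definition quat_one : H := (1, 0, 0, 0).

Definition quat_mul (x y : H) : H :=
  let: (a, b, c, d) := x in let: (a', b', c', d') := y in
  (a * a' - b * b' - c * c' - d * d',
   a * b' + b * a' + c * d' - d * c',
   a * c' - b * d' + c * a' + d * b',
   a * d' + b * c' - c * b' + d * a').

Definition quat_conj (x : H) : H := let: (a, b, c, d) := x in (a, - b, - c, - d).

Definition quat_norm (x : H) : R :=
  let: (a, b, c, d) := x in Num.sqrt (a ^+ 2 + b ^+ 2 + c ^+ 2 + d ^+ 2).

Fact quat_addE (a b c d a' b' c' d' : R) :
  ((a, b, c, d) : H) + ((a', b', c', d') : H) = (a + a', b + b', c + c', d + d').
Proof. by []. Qed.

Fact quat_mulA : associative quat_mul.
Proof.
move=> [[[a b] c] d] [[[a' b'] c'] d'] [[[x y] z] t] /=.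
by congr (_, _, _, _); ring.
Qed.
Fact quat_mul1l : left_id quat_one quat_mul.
Proof. by move=> [[[a b] c] d] /=; congr (_, _, _, _); ring. Qed.
Fact quat_mul1r : right_id quat_one quat_mul.
Proof. by move=> [[[a b] c] d] /=; congr (_, _, _, _); ring. Qed.
Fact quat_mulDl : left_distributive quat_mul +%R.
Proof.
move=> [[[a b] c] d] [[[a' b'] c'] d'] [[[x y] z] t].
by rewrite quat_addE /= quat_addE; congr (_, _, _, _); ring.
Qed.
Fact quat_mulDr : right_distributive quat_mul +%R.
Proof.
move=> [[[a b] c] d] [[[a' b'] c'] d'] [[[x y] z] t].
by rewrite quat_addE /= quat_addE; congr (_, _, _, _); ring.
Qed.
Fact quat_one_neq0 : quat_one != 0.
Proof. by apply/eqP => -[/eqP]; rewrite oner_eq0. Qed.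

HB.instance Definition _ := GRing.Zmodule_isNzRing.Build H
  quat_mulA quat_mul1l quat_mul1r quat_mulDl quat_mulDr quat_one_neq0.

Fact quat_conjD (x y : H) : quat_conj (x + y) = quat_conj x + quat_conj y.
Proof.
move: x y => [[[a b] c] d] [[[a' b'] c'] d'].
by rewrite quat_addE /= quat_addE; congr (_, _, _, _); ring.
Qed.
Fact quat_conjM (x y : H) : quat_conj (x * y) = quat_conj y * quat_conj x.
Proof.
move: x y => [[[a b] c] d] [[[a' b'] c'] d'].
by rewrite /GRing.mul /=; congr (_, _, _, _); ring.
Qed.
Fact quat_conjK : involutive quat_conj.
Proof. by move=> [[[a b] c] d] /=; rewrite !opprK. Qed.
Fact quat_conj_normal (x : H) : quat_conj x * x = x * quat_conj x.
Proof.
move: x => [[[a b] c] d].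
by rewrite /GRing.mul /=; congr (_, _, _, _); ring.
Qed.
Fact quat_norm_eq1 (x : H) : quat_norm x = 1 <-> x * quat_conj x = 1.
Proof.
move: x => [[[a b] c] d].
have -> : ((a, b, c, d) : H) * quat_conj (a, b, c, d) =
    (a ^+ 2 + b ^+ 2 + c ^+ 2 + d ^+ 2, 0, 0, 0).
  by rewrite [LHS]/GRing.mul /=; congr (_, _, _, _); ring.
rewrite /quat_norm; set s := _ + d ^+ 2.
have s0 : 0 <= s by rewrite !addr_ge0 ?sqr_ge0.
split=> [h|[h]]; last by rewrite h sqrtr1.
by rewrite -[s]sqr_sqrtr// h expr1n.
Qed.

Definition quaternion_conj_norm : conj_norm R H :=
  ConjNorm quat_conjD quat_conjM quat_conjK quat_conj_normal quat_norm_eq1.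
End Quaternion.

Section Polygons.
Variables (R : realType) (n k : nat).

(* [`|v|] would be the sup norm. *)
Definition euclidean_norm (v : 'cV[R]_n) : R :=
  Num.sqrt (\sum_(a < n) v a ord0 ^+ 2).

(* The vector p(i) is the i-th column of p. *)
Definition polygons : set 'M[R]_(n, k) :=
  [set p | \sum_(i < k) col i p = 0 /\
           \sum_(i < k) euclidean_norm (col i p) = 1].

Local Notation On := (unitary (real_conj_norm R) n).

Fact norm_unitary (A : On) v : euclidean_norm (val A *m v) = euclidean_norm v.
Proof.
have [_ A2] := unitaryP A.
have adjT (m p : nat) (B : 'M[R]_(m, p)) : adjmx (real_conj_norm R) B = B^T.
  by apply/matrixP => i j; rewrite !mxE.
have nE (w : 'cV[R]_n) : \sum_(a < n) w a ord0 ^+ 2 = (w^T *m w) ord0 ord0.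
  by rewrite mxE; apply: eq_bigr => a _; rewrite !mxE expr2.
rewrite /euclidean_norm !nE; congr (Num.sqrt _).
rewrite trmx_mul mulmxA -(mulmxA v^T) -[(val A)^T]adjT.
by rewrite [adjmx _ _ *m _]A2 mulmx1.
Qed.

Fact col_mulmx (A : 'M[R]_n) (p : 'M[R]_(n, k)) i : col i (A *m p) = A *m col i p.
Proof. by rewrite !colE mulmxA. Qed.

Fact polygon_lact_mem (A : On) (p : polygons) : val A *m val p \in polygons.
Proof.
have /= [p0 p1] := set_mem (valP p); apply/mem_set; split.
  under eq_bigr do rewrite col_mulmx.
  by rewrite -mulmx_sumr [X in _ *m X]p0 mulmx0.
by rewrite -p1; apply: eq_bigr => i _; rewrite col_mulmx norm_unitary.
Qed.

(* Column i of A *m p is A p(i). *)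
Definition polygon_lact (A : On) (p : polygons) : polygons :=
  Sub (val A *m val p) (polygon_lact_mem A p).

Fact polygon_lact1 p : polygon_lact 1%g p = p.
Proof. by apply: val_inj; rewrite SubK val_unitary1 mul1mx. Qed.
Fact polygon_lactM (A B : On) p :
  polygon_lact (A * B)%g p = polygon_lact A (polygon_lact B p).
Proof. by apply: val_inj; rewrite !SubK mulmxA. Qed.

Definition polygon_laction : laction On polygons :=
  LAction polygon_lact1 polygon_lactM.

Definition polygon_space : topologicalType :=
  lorbits (restr_laction (special_incl (real_conj_norm R) n) polygon_laction).
End Polygons.
Arguments polygons : clear implicits.

Section Grassmannians.
Variables (R : realType) (k : nat).

Definition SO2_laction :=
  restr_laction (special_incl (real_conj_norm R) 2)
    (stiefel_laction (real_conj_norm R) k).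
Definition SU2_laction :=
  restr_laction (special_incl (complex_conj_norm R) 2)
    (stiefel_laction (complex_conj_norm R) k).
Definition Sp2_laction := stiefel_laction (quaternion_conj_norm R) k.

Definition oriented_Gr : topologicalType := lorbits SO2_laction.
Definition SU2_stiefel : topologicalType := lorbits SU2_laction.
Definition quaternionic_Gr : topologicalType := lorbits Sp2_laction.

Definition oriented_Gr_mod_O1 : topologicalType :=
  rorbits (induced_raction (l := SO2_laction)
    (r := stiefel_raction (real_conj_norm R) k)
    (fun g X c => stiefel_actC (val g) X c)).
Definition SU2_stiefel_mod_U1 : topologicalType :=
  rorbits (induced_raction (l := SU2_laction)
    (r := stiefel_raction (complex_conj_norm R) k)
    (fun g X c => stiefel_actC (val g) X c)).
Definition quaternionic_Gr_mod_H1 : topologicalType :=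
  rorbits (induced_raction (l := Sp2_laction)
    (r := stiefel_raction (quaternion_conj_norm R) k)
    (@stiefel_actC _ _ (quaternion_conj_norm R) k)).
End Grassmannians.

(* Main.v *)
Require Import Defs.
From mathcomp Require Import all_boot all_order all_algebra.
From mathcomp Require Import all_classical all_reals all_analysis.
From HB Require Import structures.
From mathcomp Require Import complex ring lra.
Import Order.TTheory GRing.Theory Num.Theory.
Import numFieldNormedType.Exports.

(** Let F be R, C or H, of real dimension d. A column x = (a, b) of a Stiefel
    matrix satisfies x x^* = h(x) + |h(x)| I, where the Hopf map
    h(x) = ((|a|^2 - |b|^2)/2, a b^* ) takes values in R^(1+d), identified with
    the traceless Hermitian 2x2 matrices over F, and has the F(1)-orbits as its
    fibres. Hence X X^* = I says exactly that the vectors h(x_i) form a closed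
    polygon of perimeter 1. Left multiplication by A becomes conjugation by A on
    Hermitian matrices; a unit vector u is a matrix of square 1, and
    w |-> - u w u is the reflection along u, so that by Cartan-Dieudonné
    conjugations realize all rotations. Conversely, if conjugation by A reversed
    the orientation, then A would differ from a product of an odd number of unit
    vectors by a matrix anticommuting with all traceless Hermitian matrices,
    which is impossible. The inverse homeomorphism is continuous because the Hopf
    map has, for each v, a section which is continuous at v. *)

Set Implicit Arguments.
Unset Strict Implicit.
Unset Printing Implicit Defensive.

Local Open Scope classical_set_scope.
Local Open Scope ring_scope.
Local Open Scope quotient_scope.

(** * Reflections *)

Section Reflections.
Variables (R : realType) (n : nat).
Implicit Types (u v w x y : 'cV[R]_n) (g : 'M[R]_n) (a : R).

Definition dot u v : R := (u^T *m v) ord0 ord0.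

Lemma dotE u v : dot u v = \sum_i u i ord0 * v i ord0.
Proof. by rewrite /dot mxE; apply: eq_bigr => i _; rewrite mxE. Qed.

Lemma trmx_mul_dot u v : u^T *m v = (dot u v)%:M.
Proof. exact: mx11_scalar. Qed.

Lemma dotC u v : dot u v = dot v u.
Proof. by rewrite !dotE; apply: eq_bigr => i _; rewrite mulrC. Qed.

Lemma dotDl u v w : dot (u + v) w = dot u w + dot v w.
Proof. by rewrite /dot linearD mulmxDl mxE. Qed.

Lemma dotZl a u w : dot (a *: u) w = a * dot u w.
Proof. by rewrite /dot linearZ -scalemxAl mxE. Qed.

Lemma dotDr u v w : dot w (u + v) = dot w u + dot w v.
Proof. by rewrite dotC dotDl !(dotC w). Qed.

Lemma dotZr a u w : dot w (a *: u) = a * dot w u.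
Proof. by rewrite dotC dotZl dotC. Qed.

Lemma dotBl u v w : dot (u - v) w = dot u w - dot v w.
Proof. by rewrite dotDl -scaleN1r dotZl mulN1r. Qed.

Lemma dotBr u v w : dot w (u - v) = dot w u - dot w v.
Proof. by rewrite dotC dotBl !(dotC w). Qed.

Lemma dot_ge0 u : 0 <= dot u u.
Proof. by rewrite dotE sumr_ge0// => i _; rewrite -expr2 sqr_ge0. Qed.

Lemma dot_eq0 u : dot u u = 0 -> u = 0.
Proof.
rewrite dotE => /eqP; rewrite psumr_eq0; last first.
  by move=> i _; rewrite -expr2 sqr_ge0.
move=> /allP u0; apply/matrixP => i j; rewrite mxE (ord1 j); apply/eqP.
by have := u0 i (mem_index_enum i); rewrite mulf_eq0 orbb.
Qed.

Lemma euclidean_normE u : euclidean_norm u = Num.sqrt (dot u u).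
Proof. by rewrite /euclidean_norm dotE. Qed.

Lemma dot_orthogonal g x y : g^T *m g = 1%:M -> dot (g *m x) (g *m y) = dot x y.
Proof. by move=> g1; rewrite /dot trmx_mul mulmxA -(mulmxA x^T) g1 mulmx1. Qed.

Definition reflection u : 'M[R]_n := 1%:M - (2 *: u) *m u^T.

Lemma reflectionE u w : reflection u *m w = w - (2 * dot u w) *: u.
Proof.
by rewrite mulmxBl mul1mx -mulmxA trmx_mul_dot mul_mx_scalar scalerA mulrC.
Qed.

Lemma reflectionK u : dot u u = 1 -> reflection u *m reflection u = 1%:M.
Proof.
move=> u1; rewrite /reflection mulmxBr mulmx1 mulmxBl mul1mx.
rewrite mulmxA -(mulmxA _ u^T) trmx_mul_dot dotZr u1 mulr1 mul_mx_scalar.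
rewrite -scalemxAl; set W := _ *m u^T.
by rewrite -!scalemxAl -/W [2 *: (_ *: _)]scaler_nat mulr2n opprB addrK subrK.
Qed.

Lemma tr_reflection u : (reflection u)^T = reflection u.
Proof.
by rewrite /reflection linearB /= trmx1 trmx_mul trmxK linearZ -scalemxAl -scalemxAr.
Qed.

(** This is the matrix determinant lemma: a block factorization trades the n x n determinant for the
    1 x 1 determinant 1 - 2. *)
Lemma det_reflection u : dot u u = 1 -> \det (reflection u) = -1.
Proof.
move=> u1.
(* Both products have the blocks 1, 2 u^T, u, 1; |u| = 1 enters in the upper left one, -1 + 2 u^T u
   = 1. *)
have eq_blocks : block_mx 1%:M 0 u 1%:M *m block_mx 1%:M (2 *: u^T) 0 (reflection u) =
    block_mx (1 - 2)%:M (2 *: u^T) 0 1%:M *m block_mx 1%:M 0 u 1%:M :> 'M[R]_(1 + n).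
  rewrite !mulmx_block !mulmx0 !mul0mx !mulmx1 !mul1mx !addr0 !add0r.
  rewrite -!scalemxAl -!scalemxAr trmx_mul_dot u1; congr block_mx.
    by rewrite raddfB /= -[2%:M]scalemx1 subrK.
  by rewrite /reflection -scalemxAl addrC subrK.
have := congr1 determinant eq_blocks.
rewrite !det_mulmx !det_lblock !det_ublock !det1 !mul1r !mulr1 => ->.
by rewrite det_scalar1; ring.
Qed.

(* Cartan-Dieudonné: reflecting along [g e - e] sends [g e] to [e] and moves
   no basis vector which [g] already fixes. *)
Lemma orthogonal_ind (P : 'M[R]_n -> Prop) :
    P 1%:M ->
    (forall u g, dot u u = 1 -> g^T *m g = 1%:M -> P g -> P (reflection u *m g)) ->
  forall g, g^T *m g = 1%:M -> P g.
Proof.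
move=> P1 Prefl.
pose e (i : 'I_n) : 'cV[R]_n := delta_mx i ord0.
(* Induction on the number m of trailing basis vectors that g may still move. *)
suff step m : (m <= n)%N -> forall g, g^T *m g = 1%:M ->
    (forall i : 'I_n, (i < n - m)%N -> g *m e i = e i) -> P g.
  by move=> g g1; apply: (step n) => // i; rewrite subnn.
elim: m => [|m IHm] lemn g g1 fixg.
  suff -> : g = 1%:M by [].
  apply/matrixP => i j.
  have := fixg j; rewrite subn0 => /(_ (ltn_ord j)) /matrixP/(_ i ord0).
  by rewrite -colE !mxE eqxx andbT.
(* The index n - m - 1 is that of the first basis vector not yet known to be fixed. *)
have ltin : (n - m.+1 < n)%N by rewrite ltn_subrL /= (leq_ltn_trans _ lemn).
pose i0 := Ordinal ltin.
have ilt i : (i < n - m)%N -> (i < n - m.+1)%N \/ i = i0 :> nat.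
  by rewrite -subSS subSn// ltnS leq_eqVlt => /orP[/eqP|]; [right|left].
have [ge0|v0] := eqVneq (g *m e i0) (e i0).
  apply: IHm => [|//|i /ilt[|/val_inj->//]]; [exact: ltnW|exact: fixg].
pose v := g *m e i0 - e i0.
have vv0 : dot v v != 0.
  by apply: contra_neq v0 => /dot_eq0/eqP; rewrite subr_eq0 => /eqP.
have vv_gt0 : 0 < dot v v by rewrite lt_def vv0 dot_ge0.
pose u := (Num.sqrt (dot v v))^-1 *: v.
have u1 : dot u u = 1.
  rewrite dotZl dotZr mulrA -invfM -expr2 sqr_sqrtr ?dot_ge0//.
  by rewrite mulVf.
have reflv w : reflection u *m w = w - (2 * dot v w / dot v v) *: v.
  rewrite reflectionE dotZl scalerA; congr (_ - _ *: _).
  rewrite -[in RHS](sqr_sqrtr (dot_ge0 v)) expr2 invfM.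
  by ring.
have -> : g = reflection u *m (reflection u *m g).
  by rewrite mulmxA reflectionK// mul1mx.
have g'1 : (reflection u *m g)^T *m (reflection u *m g) = 1%:M.
  by rewrite trmx_mul tr_reflection mulmxA -(mulmxA g^T) reflectionK// mulmx1.
apply: Prefl => //; apply: IHm => [|//|i /ilt[lti|/val_inj->]].
- exact: ltnW.
- rewrite -mulmxA fixg// reflv.
  (* As g fixes e_i and preserves the dot product, g e_i0 and e_i0 have the same product with
     e_i. *)
  suff -> : dot v (e i) = 0 by rewrite mulr0 mul0r scale0r subr0.
  rewrite dotC dotBr -{1}(fixg i lti) dot_orthogonal// subrr//.
- rewrite -mulmxA reflv.
  (* Since |g e_i0| = |e_i0|, the reflection subtracts exactly v, and g e_i0 - v = e_i0. *)
  have -> : 2 * dot v (g *m e i0) = dot v v.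
    by rewrite /v !(dotBl, dotBr) !dot_orthogonal// (dotC (e i0)); ring.
  by rewrite divff// scale1r opprB addrC subrK.
Qed.

End Reflections.

(** * Traceless Hermitian matrices *)

(** This only puts a topology and a ring structure on one carrier; the continuity of multiplication
    and conjugation is demanded in [real_coordinates]. *)
#[short(type="topNzRingType")]
HB.structure Definition TopNzRing := {F of Topological F & GRing.NzRing F}.

HB.instance Definition _ (R : realType) := GRing.NzRing.on (Real.sort R).
HB.instance Definition _ (R : realType) := GRing.NzRing.on R[i].
HB.instance Definition _ (R : realType) := GRing.NzRing.on (quaternion R).

(* The structure common to R, C and H: F is a topological real algebra of
   dimension d, [emb] is the inclusion of R and [vcoord] is an isometry with
   Euclidean space. *)
Record real_coordinates (R : realType) (F : topNzRingType) (S : conj_norm R F)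
    (d : nat) := RealCoordinates {
  emb : {rmorphism R -> F};
  vcoord : F -> 'cV[R]_d;
  vcoord_inv : 'cV[R]_d -> F;
  emb_comm : forall a x, emb a * x = x * emb a;
  cj_emb : forall a, cj S (emb a) = emb a;
  vcoordK : cancel vcoord vcoord_inv;
  vcoord_invK : cancel vcoord_inv vcoord;
  vcoordD : {morph vcoord : x y / x + y};
  vcoord_emb : forall a x, vcoord (emb a * x) = a *: vcoord x;
  mul_cj : forall x, x * cj S x = emb (dot (vcoord x) (vcoord x));
  mul_cont : continuous (fun p : F * F => p.1 * p.2);
  cj_cont : continuous (cj S);
  emb_cont : continuous emb;
  vcoord_cont : continuous vcoord;
  vcoord_inv_cont : continuous vcoord_inv }.

(** * Two-by-two matrices by their entries *)

Section Matrix2.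
Variable T : Type.

Definition mx2 (a b c e : T) : 'M[T]_2 := \matrix_(i, j)
  if i == ord0 then (if j == ord0 then a else b) else (if j == ord0 then c else e).

Lemma ord2P (P : 'I_2 -> Prop) : P ord0 -> P ord_max -> forall i, P i.
Proof.
move=> P0 P1 i; have : i \in [:: ord0; ord_max] by case: i => [[|[|]]].
by rewrite !inE => /orP[]/eqP->.
Qed.

Lemma mx2_ext (A B : 'M[T]_2) :
  A ord0 ord0 = B ord0 ord0 -> A ord0 ord_max = B ord0 ord_max ->
  A ord_max ord0 = B ord_max ord0 -> A ord_max ord_max = B ord_max ord_max ->
  A = B.
Proof.
by move=> *; apply/matrixP; elim/ord2P; elim/ord2P.
Qed.

Lemma mx2E (A : 'M[T]_2) :
  A = mx2 (A ord0 ord0) (A ord0 ord_max) (A ord_max ord0) (A ord_max ord_max).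
Proof. by apply: mx2_ext; rewrite mxE. Qed.

Lemma mx2_inj a b c e a' b' c' e' : mx2 a b c e = mx2 a' b' c' e' ->
  [/\ a = a', b = b', c = c' & e = e'].
Proof.
move=> /matrixP E; have := (E ord0 ord0, E ord0 ord_max, E ord_max ord0, E ord_max ord_max).
by rewrite !mxE /= => -[[[]]].
Qed.
End Matrix2.

Section Matrix2Ring.
Variable F : nzRingType.
Implicit Types a b c e : F.

Lemma mx2M a b c e a' b' c' e' : mx2 a b c e *m mx2 a' b' c' e' =
  mx2 (a * a' + b * c') (a * b' + b * e') (c * a' + e * c') (c * b' + e * e').
Proof.
by apply: mx2_ext; rewrite !mxE big_ord_recl big_ord1 !mxE.
Qed.

Lemma mx2D a b c e a' b' c' e' : mx2 a b c e + mx2 a' b' c' e' =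
  mx2 (a + a') (b + b') (c + c') (e + e').
Proof. by apply: mx2_ext; rewrite !mxE. Qed.

Lemma mx2N a b c e : - mx2 a b c e = mx2 (- a) (- b) (- c) (- e).
Proof. by apply: mx2_ext; rewrite !mxE. Qed.

Lemma scalar_mx2 a : a%:M = mx2 a 0 0 a.
Proof. by apply: mx2_ext; rewrite !mxE. Qed.

Lemma adjmx_mx2 (R : realType) (S : conj_norm R F) a b c e :
  adjmx S (mx2 a b c e) = mx2 (cj S a) (cj S c) (cj S b) (cj S e).
Proof. by apply: mx2_ext; rewrite !mxE. Qed.
End Matrix2Ring.

(** * The norm of F and the Clifford relations *)

Section Hermitian.
Variables (R : realType) (F : topNzRingType) (S : conj_norm R F) (d : nat).
Variable C : real_coordinates S d.
Local Notation emb := (emb C).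
Local Notation vcoord := (vcoord C).
Local Notation cj := (cj S).
Local Notation adj := (adjmx S).
Implicit Types (u v w : 'cV[R]_(1 + d)) (A B : 'M[F]_2) (x y : F) (t : R).

(** The squared absolute value; [nm] is specified only where it takes the value 1. *)
Definition nsq x : R := dot (vcoord x) (vcoord x).

Lemma cjN x : cj (- x) = - cj x.
Proof. by apply: (addrI (cj x)); rewrite -cjD !subrr cj0. Qed.

Lemma emb_inj : injective emb.
Proof. exact: fmorph_inj. Qed.

Lemma vcoord0 : vcoord 0 = 0.
Proof. by apply: (addrI (vcoord 0)); rewrite -vcoordD !addr0. Qed.

Lemma vcoord_inj : injective vcoord.
Proof. exact: can_inj (vcoordK C). Qed.

Lemma nsq_ge0 x : 0 <= nsq x.
Proof. exact: dot_ge0. Qed.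

Lemma nsq_eq0 x : nsq x = 0 -> x = 0.
Proof. by move=> /dot_eq0; rewrite -vcoord0 => /vcoord_inj. Qed.

Lemma mulcj x : x * cj x = emb (nsq x).
Proof. exact: mul_cj. Qed.

Lemma cjmul x : cj x * x = emb (nsq x).
Proof. by rewrite cj_normal mulcj. Qed.

Lemma nsq0 : nsq 0 = 0.
Proof. by apply: emb_inj; rewrite -mulcj mul0r rmorph0. Qed.

Lemma nsq_cj x : nsq (cj x) = nsq x.
Proof. by apply: emb_inj; rewrite -!mulcj cjK cj_normal. Qed.

(** The product y y^* is real, hence central, and can be moved out from between x and x^*. *)
Lemma nsqM x y : nsq (x * y) = nsq x * nsq y.
Proof.
apply: emb_inj; rewrite -mulcj cjM mulrA -(mulrA x) mulcj -(emb_comm C).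
by rewrite -mulrA mulcj -rmorphM mulrC.
Qed.

Lemma nsq_emb t : nsq (emb t) = t ^+ 2.
Proof. by apply: emb_inj; rewrite -mulcj cj_emb -rmorphM. Qed.

Lemma nm_nsq x : nm S x = 1 <-> nsq x = 1.
Proof.
split=> [/nm_eq1|n1]; first by rewrite mulcj -(rmorph1 emb) => /emb_inj.
by apply/nm_eq1; rewrite mulcj n1 rmorph1.
Qed.

(** Vectors of R^(1+d) are handled as pairs of a real head t and a tail x in F. *)
Definition pack t x : 'cV[R]_(1 + d) := col_mx t%:M (vcoord x).
Definition vhead v : R := usubmx v ord0 ord0.
Definition vtail v : F := vcoord_inv C (dsubmx v).

Lemma packK v : pack (vhead v) (vtail v) = v.
Proof.
rewrite /pack /vtail vcoord_invK -[RHS]vsubmxK; congr col_mx.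
exact/esym/mx11_scalar.
Qed.

Lemma vhead_pack t x : vhead (pack t x) = t.
Proof. by rewrite /vhead col_mxKu mxE eqxx. Qed.

Lemma vtail_pack t x : vtail (pack t x) = x.
Proof. by rewrite /vtail col_mxKd vcoordK. Qed.

Lemma packD t t' x x' : pack t x + pack t' x' = pack (t + t') (x + x').
Proof. by rewrite /pack add_col_mx -raddfD vcoordD. Qed.

Lemma packZ a t x : a *: pack t x = pack (a * t) (emb a * x).
Proof. by rewrite /pack scale_col_mx vcoord_emb scale_scalar_mx. Qed.

Lemma dot_pack t x : dot (pack t x) (pack t x) = t ^+ 2 + nsq x.
Proof.
rewrite {1}/dot /pack tr_col_mx mul_row_col mxE; congr (_ + _).
by rewrite tr_scalar_mx -scalar_mxM mxE eqxx expr2.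
Qed.

(* Identifies R^(1+d) with the traceless Hermitian matrices. *)
Definition herm v : 'M[F]_2 :=
  mx2 (emb (vhead v)) (vtail v) (cj (vtail v)) (- emb (vhead v)).

Lemma herm_pack t x : herm (pack t x) = mx2 (emb t) x (cj x) (- emb t).
Proof. by rewrite /herm vhead_pack vtail_pack. Qed.

Lemma herm_inj : injective herm.
Proof.
move=> v w; rewrite -(packK v) -(packK w) !herm_pack => E.
by have [/emb_inj-> -> _ _] := mx2_inj E.
Qed.

Lemma hermD v w : herm (v + w) = herm v + herm w.
Proof.
rewrite -(packK v) -(packK w) packD !herm_pack mx2D rmorphD cjD opprD //.
Qed.

Lemma hermZ a v : herm (a *: v) = emb a *: herm v.
Proof.
rewrite -(packK v) packZ !herm_pack; apply: mx2_ext; rewrite !mxE //=.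
- by rewrite rmorphM.
- by rewrite cjM cj_emb emb_comm.
- by rewrite mulrN rmorphM.
Qed.

Lemma herm0 : herm 0 = 0.
Proof. by apply: (addrI (herm 0)); rewrite -hermD !addr0. Qed.

Lemma hermN v : herm (- v) = - herm v.
Proof. by apply: (addrI (herm v)); rewrite -hermD !subrr herm0. Qed.

Lemma herm_sum k (v : 'I_k -> 'cV[R]_(1 + d)) :
  herm (\sum_i v i) = \sum_i herm (v i).
Proof. exact: (big_morph _ hermD herm0). Qed.

Lemma herm_adj v : adj (herm v) = herm v.
Proof. by rewrite /herm adjmx_mx2 cjN cjK cj_emb. Qed.

Lemma herm_sqr v : herm v *m herm v = (emb (dot v v))%:M.
Proof.
rewrite -(packK v); set t := vhead v; set x := vtail v.
rewrite herm_pack mx2M scalar_mx2 dot_pack rmorphD rmorphXn /= expr2.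
rewrite mulcj cjmul !(mulrN, mulNr) opprK (emb_comm C t x) subrr.
by rewrite (emb_comm C t (cj x)) subrr [emb (nsq x) + _]addrC.
Qed.

(** Real numbers are central in F, so real scalar matrices commute with all matrices even over the
    quaternions. *)
Lemma scalar_emb_comm t A : (emb t)%:M *m A = A *m (emb t)%:M.
Proof.
rewrite (mx2E A) scalar_mx2 !mx2M !(mul0r, mulr0, addr0, add0r).
by rewrite !(emb_comm C).
Qed.

Lemma emb_scalar_inj (t t' : R) : (emb t)%:M = (emb t')%:M :> 'M[F]_2 -> t = t'.
Proof. by move=> /matrixP/(_ ord0 ord0); rewrite !mxE => /emb_inj. Qed.

(** Polarization of [herm_sqr]. *)
Lemma herm_clifford v w :
  herm v *m herm w + herm w *m herm v = (emb (2 * dot v w))%:M.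
Proof.
have := herm_sqr (v + w); rewrite hermD mulmxDl !mulmxDr !herm_sqr.
rewrite !(dotDl, dotDr) (dotC w v).
have -> : dot v v + dot v w + (dot v w + dot w w) =
  dot v v + 2 * dot v w + dot w w by ring.
by rewrite !rmorphD /= !addrA => /addIr; rewrite -addrA => /addrI.
Qed.

(** Multiplying u w + w u = 2<u, w> by u on the right and using u^2 = 1 gives 2<u, w> u = u w u + w,
    which is subtracted from w. *)
Lemma herm_reflection u w : dot u u = 1 ->
  herm (reflection u *m w) = - (herm u *m herm w *m herm u).
Proof.
move=> u1; rewrite reflectionE hermD hermN hermZ.
have /eqP := herm_clifford u w; rewrite eq_sym -subr_eq => /eqP <-.
rewrite mulmxBl -mulmxA herm_sqr u1 rmorph1 mulmx1 opprB mul_scalar_mx.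
by [].
Qed.
End Hermitian.

(** * Conjugations, rotations and the Hopf map *)

Lemma linear_mx (R : realType) n (f : 'cV[R]_n -> 'cV[R]_n) :
    {morph f : v w / v + w} -> (forall a, {morph f : v / a *: v}) ->
  exists g : 'M[R]_n, forall w, f w = g *m w.
Proof.
move=> fD fZ; pose e (j : 'I_n) : 'cV[R]_n := delta_mx j ord0.
have f0 : f 0 = 0 by apply: (addrI (f 0)); rewrite -fD !addr0.
exists (\matrix_(i, j) f (e j) i ord0) => w.
have {1}-> : w = \sum_j w j ord0 *: e j.
  by rewrite {1}[w]matrix_sum_delta; apply: eq_bigr => j _; rewrite big_ord1.
rewrite (big_morph f fD f0); apply/matrixP => i j.
rewrite (ord1 j) !mxE summxE; apply: eq_bigr => l _.
by rewrite fZ !mxE mulrC.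
Qed.

Section Spin.
Variables (R : realType) (F : topNzRingType) (S : conj_norm R F) (d : nat).
Variable C : real_coordinates S d.
Local Notation emb := (emb C).
Local Notation vcoord := (vcoord C).
Local Notation cj := (cj S).
Local Notation nsq := (nsq C).
Local Notation adj := (adjmx S).
Local Notation herm := (herm C).
Implicit Types (u v w : 'cV[R]_(1 + d)) (A B : 'M[F]_2) (g : 'M[R]_(1 + d)).
Implicit Types (us : seq 'cV[R]_(1 + d)).

Definition unit_vectors us := all (fun u => dot u u == 1) us.

(** For unit vectors this is the matrix of an element of the Pin group, a product of vectors in the
    Clifford algebra. *)
Definition pin us : 'M[F]_2 := foldr (fun u A => herm u *m A) 1%:M us.

Lemma pin_unitary us : unit_vectors us -> unitary_set S 2 (pin us).
Proof.
elim: us => [_|u us IHus] /=.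
  by rewrite /unitary_set /= adjmx1 mulmx1.
move=> /andP[/eqP u1 /IHus [P1 P2]]; rewrite /unitary_set /= adjmxM herm_adj.
have h1 : herm u *m herm u = 1%:M by rewrite herm_sqr u1 rmorph1.
split; rewrite mulmxA.
  by rewrite -(mulmxA (herm u)) P1 mulmx1.
by rewrite -(mulmxA (adj _)) h1 mulmx1.
Qed.

(** Along a decomposition into reflections, each reflection contributes one factor to the product
    and one sign both to the determinant and to the conjugation formula. *)
Lemma pin_lift g : g^T *m g = 1%:M -> exists us,
  [/\ unit_vectors us, \det g = (-1) ^+ size us & forall w,
      herm (g *m w) = (-1) ^+ size us *: (pin us *m herm w *m adj (pin us))].
Proof.
elim/orthogonal_ind => {g} [|u g u1 _ [us [us1 detg gE]]].
  by exists [::]; split=> [||w]; rewrite ?det1 //= adjmx1 mulmx1 !mul1mx scale1r.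
exists (u :: us); split; first by rewrite /= u1 eqxx.
  by rewrite det_mulmx det_reflection// detg exprS.
move=> w; rewrite -mulmxA (herm_reflection C)// gE adjmxM herm_adj.
rewrite -[in LHS]signr_odd -[in RHS]signr_odd !scaler_sign [odd (size (u :: us))]/=.
by case: odd => /=; rewrite ?mulmxN ?mulNmx ?opprK !mulmxA.
Qed.

Lemma spin_lift g : g^T *m g = 1%:M -> \det g = 1 -> exists us,
  [/\ unit_vectors us, ~~ odd (size us) &
      forall w, herm (g *m w) = pin us *m herm w *m adj (pin us)].
Proof.
move=> /pin_lift[us [us1 detg gE]] g1; exists us.
have us_even : ~~ odd (size us).
  apply/negP => us_odd; move: detg; rewrite g1 -signr_odd us_odd expr1 => /eqP.
  by rewrite -subr_eq0 opprK -[1 + 1]/(2%:R) pnatr_eq0.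
by split=> // w; rewrite gE -signr_odd scaler_sign (negbTE us_even).
Qed.

(** * The Hopf map, its sections and its fibres *)

Section Hopf.
Implicit Types x y : 'cV[F]_2.

(** Half the squared norm of x, which turns out to be the length of h(x). *)
Definition rad x : R := (nsq (x ord0 ord0) + nsq (x ord_max ord0)) / 2.

Definition hopf x : 'cV[R]_(1 + d) :=
  pack C ((nsq (x ord0 ord0) - nsq (x ord_max ord0)) / 2)
    (x ord0 ord0 * cj (x ord_max ord0)).

Lemma rad_ge0 x : 0 <= rad x.
Proof. by rewrite /rad divr_ge0// addr_ge0// nsq_ge0. Qed.

(** With a and b the squared norms of the two entries, ((a - b)/2)^2 + a b = ((a + b)/2)^2. *)
Lemma dot_hopf x : dot (hopf x) (hopf x) = rad x ^+ 2.
Proof. by rewrite dot_pack nsqM nsq_cj /rad; field. Qed.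

Lemma norm_hopf x : euclidean_norm (hopf x) = rad x.
Proof. by rewrite euclidean_normE dot_hopf sqrtr_sqr ger0_norm// rad_ge0. Qed.

Lemma outer_hopf x : x *m adj x = herm (hopf x) + (emb (rad x))%:M.
Proof.
rewrite herm_pack scalar_mx2 mx2D.
apply: mx2_ext; rewrite !mxE big_ord1 !mxE /= ?addr0.
- by rewrite (mulcj C) -rmorphD /rad; congr (emb _); field.
- by [].
- by rewrite cjM cjK.
- by rewrite (mulcj C) -rmorphN -rmorphD /rad; congr (emb _); field.
Qed.

Lemma inner_rad x : (adj x *m x) ord0 ord0 = emb (2 * rad x).
Proof.
rewrite mxE big_ord_recl big_ord1 !mxE !(cjmul C) -rmorphD /rad.
have -> : lift ord0 ord0 = ord_max :> 'I_2 by exact: val_inj.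
by congr (emb _); field.
Qed.

(** The number x^* x = 2 [rad x] does not change because A^* A = I. *)
Lemma rad_unitary A x : unitary_set S 2 A -> rad (A *m x) = rad x.
Proof.
move=> [_ A1]; have := inner_rad (A *m x).
rewrite adjmxM mulmxA -(mulmxA (adj x)) A1 mulmx1 inner_rad.
by move=> /emb_inj/mulfI->//; rewrite pnatr_eq0.
Qed.

(** The outer product x x^* is conjugated by A, and its real scalar part is unchanged by this since
    A A^* = I; the traceless part is what remains. *)
Lemma hopf_unitary A x : unitary_set S 2 A ->
  herm (hopf (A *m x)) = A *m herm (hopf x) *m adj A.
Proof.
move=> A1; have /eqP := outer_hopf (A *m x); rewrite eq_sym -subr_eq0 -addrA.
rewrite addr_eq0 => /eqP ->; rewrite rad_unitary// opprB adjmxM.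
rewrite mulmxA -(mulmxA A) outer_hopf mulmxDr mulmxDl -addrA.
rewrite -[A *m _%:M](scalar_emb_comm C) -(mulmxA _%:M) (proj1 A1) mulmx1.
by rewrite subrr addr0.
Qed.

(* Two charts of sections of the Hopf map, regular away from the negative and
   the positive first half-axis respectively (a division by 0 gives 0). *)
Definition sec0 (v : 'cV[R]_(1 + d)) : 'cV[F]_2 :=
  let a := Num.sqrt (Num.sqrt (dot v v) + vhead v) in
  \col_i if i == ord0 then emb a else cj (vtail C v) * emb a^-1.

Definition sec1 (v : 'cV[R]_(1 + d)) : 'cV[F]_2 :=
  let b := Num.sqrt (Num.sqrt (dot v v) - vhead v) in
  \col_i if i == ord0 then vtail C v * emb b^-1 else emb b.

Lemma dot_head_tail v : dot v v = vhead v ^+ 2 + nsq (vtail C v).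
Proof. by rewrite -{1 2}(packK C v) dot_pack. Qed.

(** With r = |v| and t = [vhead v], the tail has squared norm r^2 - t^2. The entries of the section
    thus have squared norms r + t and r - t, and half their difference is t. *)
Lemma hopf_sec0 v : 0 < Num.sqrt (dot v v) + vhead v -> hopf (sec0 v) = v.
Proof.
set r := Num.sqrt _; set t := vhead v; move=> r0.
have rr : nsq (vtail C v) = r ^+ 2 - t ^+ 2.
  by rewrite sqr_sqrtr ?dot_ge0// dot_head_tail addrAC subrr add0r.
rewrite /hopf !mxE /= -/r -/t; set a := Num.sqrt (r + t).
have a0 : a != 0 by rewrite sqrtr_eq0 -ltNge.
have aa : a ^+ 2 = r + t by rewrite sqr_sqrtr// ltW.
rewrite nsqM nsq_cj !nsq_emb rr exprVn aa.
rewrite cjM cjK cj_emb mulrA -rmorphM divff// rmorph1 mul1r -[RHS](packK C).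
by congr pack; rewrite -/t; field; rewrite gt_eqF.
Qed.

Lemma hopf_sec1 v : 0 < Num.sqrt (dot v v) - vhead v -> hopf (sec1 v) = v.
Proof.
set r := Num.sqrt _; set t := vhead v; move=> r0.
have rr : nsq (vtail C v) = r ^+ 2 - t ^+ 2.
  by rewrite sqr_sqrtr ?dot_ge0// dot_head_tail addrAC subrr add0r.
rewrite /hopf !mxE /= -/r -/t; set b := Num.sqrt (r - t).
have b0 : b != 0 by rewrite sqrtr_eq0 -ltNge.
have bb : b ^+ 2 = r - t by rewrite sqr_sqrtr// ltW.
rewrite nsqM !nsq_emb rr exprVn bb.
rewrite cj_emb -mulrA -rmorphM mulVf// rmorph1 mulr1 -[RHS](packK C).
by congr pack; rewrite -/t; field; rewrite gt_eqF.
Qed.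

Lemma hopf0 : hopf 0 = 0.
Proof. by apply: dot_eq0; rewrite dot_hopf /rad !mxE nsq0 addr0 mul0r expr0n. Qed.

Lemma hopf_surj v : exists x, hopf x = v.
Proof.
have [] := ltP 0 (Num.sqrt (dot v v) + vhead v) => [/hopf_sec0|le0].
  by exists (sec0 v).
(* Now [vhead v] <= -|v|, so either v = 0 or |v| - [vhead v] >= 2|v| > 0 and the other chart
   applies. *)
have := sqrtr_ge0 (dot v v); rewrite le_eqVlt => /orP[/eqP r0|r_gt0].
  exists 0; rewrite hopf0; apply/esym/dot_eq0.
  by rewrite -[LHS]sqr_sqrtr ?dot_ge0// -r0 expr0n.
by exists (sec1 v); apply: hopf_sec1; lra.
Qed.

(** The length of h(x) is half the sum of the two squared norms, its head half their difference. *)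
Lemma hopf_rad_inj x y : hopf x = hopf y ->
  [/\ nsq (x ord0 ord0) = nsq (y ord0 ord0),
      nsq (x ord_max ord0) = nsq (y ord_max ord0) &
      x ord0 ord0 * cj (x ord_max ord0) = y ord0 ord0 * cj (y ord_max ord0)].
Proof.
move=> e; have : rad x = rad y by rewrite -!norm_hopf e.
have := congr1 (@vhead _ _) e; rewrite !vhead_pack /rad => e1 e2.
by split; [lra|lra|have := congr1 (vtail C) e; rewrite !vtail_pack].
Qed.

Lemma hopf_fiber x y : hopf x = hopf y ->
  exists2 c : F, nm S c = 1 & forall i, y i ord0 = x i ord0 * c.
Proof.
move=> /hopf_rad_inj; set a := x ord0 ord0; set b := x ord_max ord0.
set a' := y ord0 ord0; set b' := y ord_max ord0 => -[na nb ab].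
have ba : b * cj a = b' * cj a' by have := congr1 cj ab; rewrite !cjM !cjK.
(* If a is invertible then c must be its inverse times a', and likewise for b. *)
have fiber (p q p' q' : F) : nsq p = nsq p' -> q * cj p = q' * cj p' ->
    p != 0 -> exists c : F, [/\ nm S c = 1, p' = p * c & q' = q * c].
  move=> np qp p0.
  have np0 : nsq p != 0 by apply: contra_neq p0; exact: nsq_eq0.
  exists (emb (nsq p)^-1 * (cj p * p')); split.
  - apply/(nm_nsq C); rewrite nsqM nsq_emb nsqM nsq_cj -np.
    by field.
  - rewrite mulrA -emb_comm -mulrA (mulrA p) (mulcj C) mulrA -rmorphM mulVf//.
    by rewrite rmorph1 mul1r.
  - rewrite mulrA -emb_comm -mulrA (mulrA q) qp -(mulrA q') (cjmul C) -np.
    by rewrite -emb_comm mulrA -rmorphM mulVf// rmorph1 mul1r.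
have [a0|a0] := eqVneq a 0; last first.
  have [c [c1 ac bc]] := fiber a b a' b' na ba a0.
  by exists c => //; elim/ord2P.
have [b0|b0] := eqVneq b 0; last first.
  have [c [c1 bc ac]] := fiber b a b' a' nb ab b0.
  by exists c => //; elim/ord2P.
(* Both entries of x vanish, hence those of y as well, and any unit c would do. *)
exists 1; first by apply/nm_eq1; rewrite cj1 mulr1.
have a'0 : a' = 0 by apply: (nsq_eq0 (C := C)); rewrite -na a0 nsq0.
have b'0 : b' = 0 by apply: (nsq_eq0 (C := C)); rewrite -nb b0 nsq0.
by elim/ord2P; rewrite mulr1 -/a -/b -/a' -/b' ?a0 ?b0 ?a'0 ?b'0.
Qed.

Lemma hopf_scale x y c : nm S c = 1 -> (forall i, y i ord0 = x i ord0 * c) ->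
  hopf y = hopf x.
Proof.
move=> c1 yx; rewrite /hopf !yx !nsqM (proj1 (nm_nsq C c) c1) !mulr1; congr pack.
by rewrite cjM mulrA -(mulrA (x ord0 ord0)) (proj1 (nm_eq1 S c) c1) mulr1.
Qed.
End Hopf.

(** Conjugation by A is linear and multiplicative, and the Clifford relation expresses the dot
    product through products of matrices. *)
Lemma conj_orthogonal A : unitary_set S 2 A -> exists2 g : 'M[R]_(1 + d),
  g^T *m g = 1%:M & forall w, herm (g *m w) = A *m herm w *m adj A.
Proof.
move=> A1.
(* For w = h(x), the matrix A w A^* is the one of h(A x); so conjugation preserves the traceless
   Hermitian matrices. *)
have /choice[f fE] w : exists v, herm v = A *m herm w *m adj A.
  by have [x <-] := hopf_surj w; exists (hopf (A *m x)); rewrite hopf_unitary.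
have [||g gE] := @linear_mx _ _ f.
- move=> v w; apply: (@herm_inj _ _ _ _ C); rewrite hermD !fE hermD.
  by rewrite mulmxDr mulmxDl.
- move=> a v; apply: (@herm_inj _ _ _ _ C); rewrite hermZ !fE hermZ.
  rewrite -!mul_scalar_mx !mulmxA; congr (_ *m _ *m _).
  exact/esym/scalar_emb_comm.
exists g => [|w]; last by rewrite -gE.
have dotg v w : dot (g *m v) (g *m w) = dot v w.
  apply: (@mulfI _ 2); first by rewrite pnatr_eq0.
  apply: (@emb_scalar_inj _ _ _ _ C).
  rewrite -!herm_clifford -!gE !fE.
  rewrite !mulmxA -!(mulmxA _ (adj A) A) (proj2 A1) !mulmx1.
  rewrite -!(mulmxA A) -mulmxDr -mulmxDl mulmxA.
  by rewrite herm_clifford -[A *m _%:M](scalar_emb_comm C) -(mulmxA _%:M) (proj1 A1) mulmx1.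
(* On basis vectors, invariance of the dot product gives the entries of g^T g. *)
apply/matrixP => i j; have := dotg (delta_mx i ord0) (delta_mx j ord0).
rewrite /dot trmx_mul mulmxA -(mulmxA _ g^T).
rewrite !trmx_delta -!rowE -!colE !mxE => ->.
by rewrite eqxx andbT eq_sym.
Qed.

(** If det g = -1, then A w A^* = - P w P^* for a product P of an odd number of unit vectors, so A^*
    P anticommutes with every w. The second hypothesis forbids this. *)
Lemma conj_special A : unitary_set S 2 A ->
    (forall us, unit_vectors us -> odd (size us) ->
       (forall w, (adj A *m pin us) *m herm w = - (herm w *m (adj A *m pin us))) ->
       False) ->
  exists g : 'M[R]_(1 + d), [/\ g^T *m g = 1%:M, \det g = 1 &
    forall w, herm (g *m w) = A *m herm w *m adj A].
Proof.
move=> A1 noD; have [g g1 gE] := conj_orthogonal A1; exists g; split=> //.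
have [us [us1 -> gus]] := pin_lift g1.
rewrite -signr_odd; case: (boolP (odd _)) => // od; exfalso.
apply: (noD us) => // w; have [_ P2] := pin_unitary us1.
have := gus w; rewrite gE -signr_odd od scaler_sign /= => E.
(* Multiplying by A^* on the left and by P on the right gives w (A^* P) = - (A^* P) w. *)
have := congr1 (fun M => adj A *m M *m pin us) E.
rewrite !mulmxA (proj2 A1) mul1mx mulmxN mulNmx.
by rewrite !mulmxA -[in RHS](mulmxA _ (adj (pin us))) P2 mulmx1 -mulmxA => ->; rewrite opprK.
Qed.
End Spin.

(** * Quotient maps and continuity of matrix-valued maps *)

Section QuotientMaps.

Definition quotient_map (X Y : topologicalType) (f : X -> Y) :=
  (forall y, exists x, f x = y) /\ forall A : set Y, open A <-> open (f @^-1` A).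

Lemma quotient_map_comp (X Y Z : topologicalType) (f : X -> Y) (g : Y -> Z) :
  quotient_map f -> quotient_map g -> quotient_map (g \o f).
Proof.
move=> [fS fo] [gS go]; split=> [z|A].
  by have [y <-] := gS z; have [x <-] := fS y; exists x.
by rewrite go fo.
Qed.

Lemma quotient_map_lorbit (G : groupType) (T : topologicalType) (a : laction G T) :
  quotient_map (lorbit a).
Proof. by split=> // y; exists (repr (y : {eq_quot lorbit_equiv a})); exact: lorbit_repr. Qed.

Lemma quotient_map_rorbit (G : groupType) (T : topologicalType) (a : raction G T) :
  quotient_map (rorbit a).
Proof.
by split=> // y; exists (repr (y : {eq_quot rorbit_equiv a})); exact: reprK.
Qed.

(* Continuous local sections of [phi] make the inverse bijection continuous,
   whence no compactness is needed. *)
Lemma homeomorphic_quotients (V M Q P : topologicalType)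
    (pV : V -> Q) (pM : M -> P) (phi : V -> M) :
  quotient_map pV -> quotient_map pM -> continuous phi ->
  (forall X Y, pV X = pV Y <-> pM (phi X) = pM (phi Y)) ->
  (forall p, exists2 s : M -> V, cancel s phi & {for p, continuous s}) ->
  homeomorphic P Q.
Proof.
move=> [/choice[sV sVK] oQ] [/choice[sM sMK] oP] phi_cont key sections.
have /choice[s sK] p : exists X, phi X = p.
  by have [s sK _] := sections p; exists (s p).
pose f p := pV (s (sM p)); pose g q := pM (phi (sV q)).
(* Any section computes f, so continuity at m can be checked with the section that is continuous at
   m. *)
have fE m t : cancel t phi -> f (pM m) = pV (t m).
  by move=> tK; apply/key; rewrite sK sMK tK.
have gE X : g (pV X) = pM (phi X) by apply/key; rewrite sVK.
exists f, g; split.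
- by move=> p; rewrite gE sK sMK.
- by move=> q; apply/(etrans _ (sVK q))/key; rewrite sK sMK.
- apply/continuousP => A oA; apply/oP; rewrite openE => m /= Am.
  have [t tK t_cont] := sections m.
  have -> : pM @^-1` (f @^-1` A) = t @^-1` (pV @^-1` A).
    by apply/seteqP; split=> x /=; rewrite (fE _ t tK).
  apply: t_cont; apply: open_nbhs_nbhs; split; first exact/oQ.
  by rewrite /= -(fE _ t tK).
- apply/continuousP => A oA; apply/oQ.
  have -> : pV @^-1` (g @^-1` A) = phi @^-1` (pM @^-1` A).
    by apply/seteqP; split=> x /=; rewrite gE.
  by move/continuousP: phi_cont; apply; exact/oP.
Qed.
End QuotientMaps.

Section MatrixContinuity.
Variables (X T : topologicalType) (m n : nat).

Lemma mx_continuous_at (f : X -> 'M[T]_(m, n)) x :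
  (forall i j, {for x, continuous (fun y => f y i j)}) -> {for x, continuous f}.
Proof.
move=> fc A [P nP sPA]; rewrite /nbhs /=.
have : \forall y \near x, forall ij : 'I_m * 'I_n, P ij.1 ij.2 (f y ij.1 ij.2).
  by apply: filter_forall => -[i j] /=; exact: fc.
by apply: filterS => y Py; apply: sPA => i j; exact: (Py (i, j)).
Qed.

Lemma entry_continuous i j : continuous (fun M : 'M[T]_(m, n) => M i j).
Proof.
move=> M A nA; exists (fun i' j' => if (i' == i) && (j' == j) then A else setT).
  move=> i' j'; case: ifP => [/andP[/eqP-> /eqP->]//|_]; exact: filterT.
by move=> N /(_ i j); rewrite !eqxx.
Qed.

Lemma set_type_continuous_at (B : set T) (f : X -> B) x :
  {for x, continuous (fun y => val (f y))} -> {for x, continuous f}.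
Proof.
move=> fc A [_ [[W oW <-]] /= Wx sWA].
have : \forall y \near x, W (val (f y)) by apply: fc; exact: open_nbhs_nbhs.
by apply: filterS => y; exact: sWA.
Qed.
End MatrixContinuity.

(** * Continuity of the Hopf map and of its sections *)

Lemma eq_near_continuous_at (X Y : topologicalType) (f g : X -> Y) x :
  (\forall y \near x, f y = g y) -> {for x, continuous f} -> {for x, continuous g}.
Proof.
move=> fg fc; rewrite /prop_for /continuous_at -(nbhs_singleton fg).
exact: cvg_trans (near_eq_cvg fg) fc.
Qed.

Lemma eq_continuous_at (X Y : topologicalType) (f g : X -> Y) x :
  f =1 g -> {for x, continuous f} -> {for x, continuous g}.
Proof. by move=> /funext->. Qed.

Section HopfContinuity.
Variables (R : realType) (F : topNzRingType) (S : conj_norm R F) (d : nat).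
Variable C : real_coordinates S d.
Variables (X : topologicalType) (x : X).
Local Notation cont f := {for x, continuous f}.

Lemma continuous_at_comp (Y Z : topologicalType) (f : X -> Y) (g : Y -> Z) :
  cont f -> continuous g -> cont (fun y => g (f y)).
Proof. by move=> fc gc; apply: continuous_comp => //; exact: gc. Qed.

(** The condition D > 0 is open, so the function agrees with t near x, whatever s is. *)
Lemma continuous_at_if (Y : topologicalType) (D : X -> R) (s t : X -> Y) :
  cont D -> 0 < D x -> cont t -> cont (fun y => if 0 < D y then t y else s y).
Proof.
move=> Dc Dx; apply: (eq_near_continuous_at (f := t)).
have pos : nbhs (D x) [set a | 0 < a].
  by apply: open_nbhs_nbhs; split => //; exact: open_gt.
have Dpos : \forall y \near x, 0 < D y := Dc _ pos.
by apply: (filterS _ Dpos) => y /= ->.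
Qed.

Lemma continuous_at_mulF (f g : X -> F) : cont f -> cont g -> cont (fun y => f y * g y).
Proof.
move=> fc gc; apply: (@continuous2_cvg X F F F (nbhs x) _ f g (fun a b => a * b) (f x) (g x)) => //.
exact: (@mul_cont _ _ _ _ C (f x, g x)).
Qed.

Lemma continuous_at_dot n (f g : X -> 'cV[R]_n) :
  cont f -> cont g -> cont (fun y => dot (f y) (g y)).
Proof.
move=> fc gc; rewrite (_ : (fun y => _) =
    fun y => \sum_i f y i ord0 * g y i ord0); last by apply/funext => y; exact: dotE.
apply: cvg_big => [|i _]; first exact: add_continuous.
by apply: cvgM; [exact: continuous_at_comp fc (@entry_continuous _ _ _ i ord0)|
  exact: continuous_at_comp gc (@entry_continuous _ _ _ i ord0)].
Qed.

Lemma continuous_at_nsq (f : X -> F) : cont f -> cont (fun y => nsq C (f y)).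
Proof.
by move=> fc; apply: continuous_at_dot; exact: continuous_at_comp fc (@vcoord_cont _ _ _ _ C).
Qed.

Lemma continuous_at_pack (f : X -> R) (g : X -> F) :
  cont f -> cont g -> cont (fun y => pack C (f y) (g y)).
Proof.
move=> fc gc; apply: mx_continuous_at => i j; rewrite (ord1 j) /pack.
case: (splitP i) => l il.
  have -> : i = lshift d l by exact: val_inj.
  by apply: eq_continuous_at fc => y; rewrite col_mxEu mxE (ord1 l) eqxx mulr1n.
have -> : i = rshift 1 l by exact: val_inj.
have cc := continuous_at_comp gc (@vcoord_cont _ _ _ _ C).
apply: eq_continuous_at (continuous_at_comp cc (@entry_continuous _ _ _ l ord0)).
by move=> y; rewrite col_mxEd.
Qed.

Lemma continuous_at_vhead (f : X -> 'cV[R]_(1 + d)) :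
  cont f -> cont (fun y => vhead (f y)).
Proof.
move=> fc.
apply: eq_continuous_at
  (continuous_at_comp fc (@entry_continuous _ _ _ (lshift d ord0) ord0)).
by move=> y; rewrite /vhead mxE.
Qed.

Lemma continuous_at_vtail (f : X -> 'cV[R]_(1 + d)) :
  cont f -> cont (fun y => vtail C (f y)).
Proof.
move=> fc; apply: continuous_at_comp (@vcoord_inv_cont _ _ _ _ C).
apply: mx_continuous_at => i j.
apply: eq_continuous_at (continuous_at_comp fc (@entry_continuous _ _ _ (rshift 1 i) j)).
by move=> y; rewrite mxE.
Qed.

Lemma continuous_at_hopf (f : X -> 'cV[F]_2) :
  cont f -> cont (fun y => hopf C (f y)).
Proof.
move=> fc.
have entry i : cont (fun y => f y i ord0).
  exact: continuous_at_comp fc (@entry_continuous _ _ _ i ord0).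
apply: continuous_at_pack.
  apply: cvgM; last exact: cvg_cst.
  by apply: cvgB; exact: continuous_at_nsq.
apply: continuous_at_mulF => //.
exact: continuous_at_comp (entry _) (@cj_cont _ _ _ _ C).
Qed.

(** The real coordinates of f are squeezed between plus and minus the square root of b, which tends
    to 0 at x. *)
Lemma continuous_at_nsq_le (f : X -> F) (b : X -> R) :
  (forall y, nsq C (f y) <= b y) -> b x = 0 -> cont b -> cont f.
Proof.
move=> fb bx0 bc.
have nc : (fun y => Num.sqrt (b y)) @ x --> (0 : R).
  have := continuous_at_comp bc (@sqrt_continuous R).
  by rewrite /prop_for /continuous_at bx0 sqrtr0.
have fx0 : f x = 0.
  by apply: (nsq_eq0 (C := C)); apply/eqP; rewrite eq_le nsq_ge0 andbT -bx0.
suff cc : cont (fun y => vcoord C (f y)).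
  rewrite (_ : f = fun y => vcoord_inv C (vcoord C (f y))).
    exact: continuous_at_comp cc (@vcoord_inv_cont _ _ _ _ C).
  by apply/funext => y; rewrite vcoordK.
apply: mx_continuous_at => i j; rewrite (ord1 j) /prop_for /continuous_at.
rewrite fx0 vcoord0 mxE.
have bound y : `|vcoord C (f y) i ord0| <= Num.sqrt (b y).
  rewrite -sqrtr_sqr ler_wsqrtr// (le_trans _ (fb y))// /nsq dotE (bigD1 i)//= -expr2 lerDl.
  by rewrite sumr_ge0// => l _; rewrite -expr2 sqr_ge0.
apply: (@squeeze_cvgr _ _ _ _ (fun y => - Num.sqrt (b y))); last exact: nc.
  by apply: nearW => y; rewrite -ler_norml.
by rewrite -[X in _ --> X]oppr0; exact: cvgN.
Qed.
End HopfContinuity.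

(** * Sections of the Hopf map continuous at a given point *)

Section HopfSections.
Variables (R : realType) (F : topNzRingType) (S : conj_norm R F) (d : nat).
Variable C : real_coordinates S d.
Implicit Types v w : 'cV[R]_(1 + d).

Lemma dot_norm_continuous :
  continuous (fun w => Num.sqrt (dot w w) : R).
Proof.
move=> v; apply: (continuous_at_comp (f := fun w : 'cV[R]_(1 + d) => dot w w)).
  by apply: continuous_at_dot; exact: cvg_id.
exact: sqrt_continuous.
Qed.

Lemma norm_add_vhead_continuous :
  continuous (fun w : 'cV[R]_(1 + d) => Num.sqrt (dot w w) + vhead w).
Proof.
move=> v; suff h : {for v, continuous
    (fun w : 'cV[R]_(1 + d) => Num.sqrt (dot w w) + vhead w)} by exact: h.
by apply: continuousD; [exact: dot_norm_continuous|apply: continuous_at_vhead; exact: cvg_id].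
Qed.

Lemma norm_sub_vhead_continuous :
  continuous (fun w : 'cV[R]_(1 + d) => Num.sqrt (dot w w) - vhead w).
Proof.
move=> v; suff h : {for v, continuous
    (fun w : 'cV[R]_(1 + d) => Num.sqrt (dot w w) - vhead w)} by exact: h.
by apply: continuousB; [exact: dot_norm_continuous|apply: continuous_at_vhead; exact: cvg_id].
Qed.

Lemma sec0_continuous_at v : 0 < Num.sqrt (dot v v) + vhead v ->
  {for v, continuous (sec0 C)}.
Proof.
move=> v0; set a := fun w => Num.sqrt (Num.sqrt (dot w w) + vhead w).
have ac : {for v, continuous a}.
  apply: (continuous_at_comp (f := fun w : 'cV[R]_(1 + d) => Num.sqrt (dot w w) + vhead w)).
    exact: norm_add_vhead_continuous.
  exact: sqrt_continuous.
have av : a v != 0 by rewrite sqrtr_eq0 -ltNge.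
apply: mx_continuous_at => i j.
apply: (eq_continuous_at (f := fun w => if i == ord0 then emb C (a w)
    else cj S (vtail C w) * emb C (a w)^-1)); first by move=> w; rewrite mxE.
case: (i == ord0); first exact: continuous_at_comp ac (@emb_cont _ _ _ _ C).
apply: (continuous_at_mulF C); last first.
  by apply: continuous_at_comp (@emb_cont _ _ _ _ C); exact: continuousV.
apply: continuous_at_comp (@cj_cont _ _ _ _ C).
by apply: continuous_at_vtail; exact: cvg_id.
Qed.

Lemma sec1_continuous_at v : 0 < Num.sqrt (dot v v) - vhead v ->
  {for v, continuous (sec1 C)}.
Proof.
move=> v0; set b := fun w => Num.sqrt (Num.sqrt (dot w w) - vhead w).
have bc : {for v, continuous b}.
  apply: (continuous_at_comp (f := fun w : 'cV[R]_(1 + d) => Num.sqrt (dot w w) - vhead w)).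
    exact: norm_sub_vhead_continuous.
  exact: sqrt_continuous.
have bv : b v != 0 by rewrite sqrtr_eq0 -ltNge.
apply: mx_continuous_at => i j.
apply: (eq_continuous_at (f := fun w => if i == ord0 then vtail C w * emb C (b w)^-1
    else emb C (b w))); first by move=> w; rewrite mxE.
case: (i == ord0); last exact: continuous_at_comp bc (@emb_cont _ _ _ _ C).
apply: (continuous_at_mulF C); last first.
  by apply: continuous_at_comp (@emb_cont _ _ _ _ C); exact: continuousV.
by apply: continuous_at_vtail; exact: cvg_id.
Qed.

(** Every section s is continuous at 0, since the entries of s(w) have squared norm at most 2|w|. *)
Lemma section_continuous_at0 (s : 'cV[R]_(1 + d) -> 'cV[F]_2) :
  cancel s (hopf C) -> {for 0, continuous s}.
Proof.
move=> sK.
have nsq_le w i : nsq C (s w i ord0) <= 2 * Num.sqrt (dot w w).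
  rewrite -{2 3}(sK w) -euclidean_normE norm_hopf /rad mulrC divfK ?pnatr_eq0//.
  by move: i; elim/ord2P; rewrite ?lerDl ?lerDr nsq_ge0.
apply: mx_continuous_at => i j; rewrite (ord1 j).
apply: (continuous_at_nsq_le (nsq_le^~ i)).
  by rewrite dotE big1 ?sqrtr0 ?mulr0// => l _; rewrite mxE mul0r.
by apply: continuousM; [exact: cst_continuous|exact: dot_norm_continuous].
Qed.

(** A chart is used if v lies in its domain; v = 0 lies in neither, and there an arbitrary section
    will do. *)
Lemma hopf_section_at v : exists2 s : 'cV[R]_(1 + d) -> 'cV[F]_2,
  cancel s (hopf C) & {for v, continuous s}.
Proof.
have /choice[s sK] := hopf_surj C.
(* The chart t is completed outside its domain D > 0 by an arbitrary set-theoretic section s. *)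
have extend (D : 'cV[R]_(1 + d) -> R) (t : 'cV[R]_(1 + d) -> 'cV[F]_2) :
    continuous D -> 0 < D v -> (forall w, 0 < D w -> hopf C (t w) = w) ->
    {for v, continuous t} -> exists2 s' : 'cV[R]_(1 + d) -> 'cV[F]_2,
      cancel s' (hopf C) & {for v, continuous s'}.
  move=> Dc Dv tK tc; exists (fun w => if 0 < D w then t w else s w).
    by move=> w; case: ifP => [/tK|].
  exact: continuous_at_if (Dc v) Dv tc.
have [v0|v0] := ltP 0 (Num.sqrt (dot v v) + vhead v).
  apply: (extend (fun w => Num.sqrt (dot w w) + vhead w) (sec0 C)) => //.
  - exact: norm_add_vhead_continuous.
  - exact: hopf_sec0.
  - exact: sec0_continuous_at.
have := sqrtr_ge0 (dot v v); rewrite le_eqVlt => /orP[/eqP r0|r_gt0].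
  have -> : v = 0 by apply: dot_eq0; rewrite -[LHS]sqr_sqrtr ?dot_ge0// -r0 expr0n.
  by exists s => //; exact: section_continuous_at0.
have v1 : 0 < Num.sqrt (dot v v) - vhead v by lra.
apply: (extend (fun w => Num.sqrt (dot w w) - vhead w) (sec1 C)) => //.
- exact: norm_sub_vhead_continuous.
- exact: hopf_sec1.
- exact: sec1_continuous_at.
Qed.
End HopfSections.

(** * From Stiefel manifolds to polygon spaces *)

Section StiefelPolygon.
Variables (R : realType) (F : topNzRingType) (S : conj_norm R F) (d : nat).
Variables (C : real_coordinates S d) (k : nat).
Local Notation herm := (herm C).
Local Notation hopf := (hopf C).
Local Notation M := (polygons R (1 + d) k).
Local Notation V := (stiefel_set S k).

Lemma mulmx_adj_cols (X : 'M[F]_(2, k)) :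
  X *m adjmx S X = \sum_(i < k) col i X *m adjmx S (col i X).
Proof.
apply/matrixP => a b; rewrite mxE summxE; apply: eq_bigr => i _.
by rewrite !mxE big_ord1 !mxE.
Qed.

(** Summing [outer_hopf] over the columns splits X X^* into a traceless Hermitian matrix and a real
    scalar; the sum is I exactly when these are 0 and 1. *)
Lemma stiefel_hopf (X : 'M[F]_(2, k)) : stiefel_set S k X <->
  \sum_(i < k) hopf (col i X) = 0 /\ \sum_(i < k) rad C (col i X) = 1.
Proof.
rewrite /stiefel_set /= mulmx_adj_cols.
rewrite (eq_bigr _ (fun i _ => outer_hopf C (col i X))).
rewrite big_split /= -herm_sum.
have -> : \sum_(i < k) (emb C (rad C (col i X)))%:M =
    (emb C (\sum_(i < k) rad C (col i X)))%:M :> 'M[F]_2.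
  by rewrite rmorph_sum raddf_sum.
set v := \sum_i hopf _; set r := \sum_i rad _ _.
split=> [|[-> ->]]; last by rewrite herm0 add0r rmorph1.
rewrite -(packK C v) herm_pack !scalar_mx2 mx2D !addr0 => E.
have [e1 e2 _ e3] := mx2_inj E.
(* The two diagonal entries determine both the scalar part r and the head of v. *)
have {}e1 : vhead v + r = 1 by apply: (emb_inj (C := C)); rewrite rmorphD rmorph1.
have {}e3 : - vhead v + r = 1.
  by apply: (emb_inj (C := C)); rewrite rmorphD rmorphN rmorph1.
have r1 : r = 1 by lra.
have h0 : vhead v = 0 by lra.
by split=> //; apply: dot_eq0; rewrite h0 e2 dot_pack nsq0 expr0n addr0.
Qed.

Definition polygon_of (X : 'M[F]_(2, k)) : 'M[R]_(1 + d, k) :=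
  \matrix_(a, i) hopf (col i X) a ord0.

Lemma col_polygon_of X i : col i (polygon_of X) = hopf (col i X).
Proof. by apply/matrixP => a j; rewrite (ord1 j) !mxE. Qed.

Lemma polygon_of_mem (X : V) : polygon_of (val X) \in M.
Proof.
have /stiefel_hopf[X0 X1] := set_mem (valP X); apply/mem_set; split.
  by rewrite -[RHS]X0; apply: eq_bigr => i _; exact: col_polygon_of.
rewrite -[RHS]X1; apply: eq_bigr => i _.
by rewrite col_polygon_of norm_hopf.
Qed.

Definition stiefel_polygon (X : V) : M := Sub (polygon_of (val X)) (polygon_of_mem X).

Lemma val_stiefel_polygon X : val (stiefel_polygon X) = polygon_of (val X).
Proof. exact: SubK. Qed.

Lemma stiefel_polygon_continuous : continuous stiefel_polygon.
Proof.
move=> X; suff h : {for X, continuous stiefel_polygon} by exact: h.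
apply: set_type_continuous_at; apply: mx_continuous_at => a i.
apply: (eq_continuous_at (f := fun Y : V => hopf (col i (val Y)) a ord0)).
  by move=> Y; rewrite val_stiefel_polygon [RHS]mxE.
refine (@continuous_at_comp _ _ _ _ (fun Y : V => hopf (col i (val Y)))
  (fun v : 'cV[R]_(1 + d) => v a ord0) _ _); last exact: entry_continuous.
apply: continuous_at_hopf; apply: mx_continuous_at => b j.
apply: (eq_continuous_at (f := fun Y : V => val Y b i)) => [Y|]; first by rewrite mxE.
refine (@continuous_at_comp _ _ _ _ (fun Y : V => val Y)
  (fun Y : 'M[F]_(2, k) => Y b i) _ _); last exact: entry_continuous.
exact: initial_continuous.
Qed.

Lemma stiefel_section_mem (s : 'I_k -> 'cV[R]_(1 + d) -> 'cV[F]_2) (p : M) :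
    (forall i, cancel (s i) hopf) ->
  (\matrix_(a, i) s i (col i (val p)) a ord0 : 'M[F]_(2, k)) \in V.
Proof.
move=> sK; have [p0 p1] := set_mem (valP p); apply/mem_set/stiefel_hopf.
have colE i : col i (\matrix_(a, i) s i (col i (val p)) a ord0) = s i (col i (val p)).
  by apply/matrixP => a j; rewrite (ord1 j) !mxE.
split.
  by rewrite -[RHS]p0; apply: eq_bigr => i _; rewrite colE sK.
by rewrite -[RHS]p1; apply: eq_bigr => i _; rewrite colE -[in RHS](sK i (col i _)) norm_hopf.
Qed.

Definition stiefel_section (s : 'I_k -> 'cV[R]_(1 + d) -> 'cV[F]_2)
    (sK : forall i, cancel (s i) hopf) (p : M) : V :=
  Sub (\matrix_(a, i) s i (col i (val p)) a ord0) (stiefel_section_mem p sK).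

(** The Hopf map is lifted column by column, with for each i a section continuous at the i-th edge
    of p. *)
Lemma stiefel_polygon_section (p : M) :
  exists2 s : M -> V, cancel s stiefel_polygon & {for p, continuous s}.
Proof.
have /choice[s sP] (i : 'I_k) : exists s : 'cV[R]_(1 + d) -> 'cV[F]_2,
    cancel s hopf /\ {for col i (val p), continuous s}.
  by have [s sK sc] := hopf_section_at C (col i (val p)); exists s.
have sK i : cancel (s i) hopf by case: (sP i).
exists (stiefel_section sK).
  move=> q; apply: val_inj; rewrite val_stiefel_polygon SubK.
  apply/matrixP => a i; rewrite mxE.
  rewrite (_ : col i _ = s i (col i (val q))) ?sK ?mxE//.
  by apply/matrixP => b j; rewrite (ord1 j) !mxE.
apply: set_type_continuous_at; apply: mx_continuous_at => a i.
apply: (eq_continuous_at (f := fun q : M => s i (col i (val q)) a ord0)).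
  by move=> q; rewrite SubK mxE.
refine (@continuous_at_comp _ _ _ _ (fun q : M => s i (col i (val q)))
  (fun v : 'cV[F]_2 => v a ord0) _ _); last exact: entry_continuous.
apply: (continuous_comp (f := fun q : M => col i (val q))); last by case: (sP i).
suff h : {for p, continuous (fun q : M => col i (val q))} by exact: h.
apply: mx_continuous_at => b j.
apply: (eq_continuous_at (f := fun q : M => val q b i)) => [q|]; first by rewrite mxE.
refine (@continuous_at_comp _ _ _ _ (fun q : M => val q)
  (fun q : 'M[R]_(1 + d, k) => q b i) _ _); last exact: entry_continuous.
exact: initial_continuous.
Qed.

Lemma stiefel_polygon_fiber (X Y : V) :
  stiefel_polygon X = stiefel_polygon Y <-> exists c, stiefel_raction S k X c = Y.
Proof.
split=> [/(congr1 val)|[c <-]].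
  rewrite !val_stiefel_polygon => XY.
  have /choice[c cP] (i : 'I_k) : exists c : unit_sphere S,
      forall a, val Y a i = val X a i * val c.
    have /hopf_fiber[c c1 cE] : hopf (col i (val X)) = hopf (col i (val Y)).
      by rewrite -!col_polygon_of XY.
    have c_mem : c \in [set c : F | nm S c = 1] by exact/mem_set.
    by exists (Sub c c_mem) => a; have := cE a; rewrite SubK !mxE.
  exists [ffun i => c i]; apply: val_inj; rewrite SubK; apply/matrixP => a i.
  by rewrite mxE ffunE cP.
apply: val_inj; rewrite !val_stiefel_polygon SubK; apply/matrixP => a i.
rewrite [LHS]mxE [RHS]mxE; congr ((_ : 'cV_ _) a ord0).
apply/esym/hopf_scale => [|b]; first exact: set_mem (valP (c i)).
by rewrite !mxE.
Qed.

Lemma polygon_of_mul (g : 'M[R]_(1 + d)) (A : 'M[F]_2) X :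
    unitary_set S 2 A ->
    (forall w, herm (g *m w) = A *m herm w *m adjmx S A) ->
  polygon_of (A *m X) = g *m polygon_of X.
Proof.
move=> A1 gA; apply/matrixP => a i.
have -> : (g *m polygon_of X) a i = (g *m hopf (col i X)) a ord0.
  by rewrite -col_polygon_of !mxE; apply: eq_bigr => b _; rewrite !mxE.
rewrite [LHS]mxE; congr ((_ : 'cV_ _) a ord0).
apply: (herm_inj (C := C)); rewrite gA -hopf_unitary//.
by rewrite !colE mulmxA.
Qed.

Local Notation SO := (special_unitary (real_conj_norm R) (1 + d)).

Lemma adjmx_real m n (A : 'M[R]_(m, n)) : adjmx (real_conj_norm R) A = A^T.
Proof. by apply/matrixP => i j; rewrite !mxE. Qed.

Lemma special_orthogonalP (g : SO) :
  (val (val g))^T *m val (val g) = 1%:M /\ \det (val (val g)) = 1.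
Proof.
have [_] := unitaryP (val g); rewrite adjmx_real => g1; split=> //.
exact/eqP/(valP g).
Qed.

Lemma special_orthogonal_exists (g : 'M[R]_(1 + d)) :
  g^T *m g = 1%:M -> \det g = 1 -> exists h : SO, val (val h) = g.
Proof.
move=> g1 detg.
have g_mem : g \in unitary_set (real_conj_norm R) (1 + d).
  by apply/mem_set; rewrite /unitary_set /= adjmx_real (mulmx1C g1).
have g_sp : special (Sub g g_mem : unitary (real_conj_norm R) (1 + d)).
  by rewrite /special SubK detg.
by exists (Sub _ g_sp); rewrite !SubK.
Qed.

(** The group G stands for SO(2), SU(2) or Sp(2) acting through [rho]. The last two hypotheses say
    that conjugations by [rho h] are exactly the rotations of R^(1+d), so double orbits of Stiefel
    matrices correspond to rotation classes of polygons. *)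
Theorem polygon_space_homeomorphic (G : groupType) (l : laction G V)
    (rho : G -> unitary S 2) (lE : forall h X, val (l h X) = val (rho h) *m val X)
    (lrC : forall h X c, stiefel_raction S k (l h X) c = l h (stiefel_raction S k X c)) :
    (forall g : 'M[R]_(1 + d), g^T *m g = 1%:M -> \det g = 1 ->
      exists h, forall w, herm (g *m w) = val (rho h) *m herm w *m adjmx S (val (rho h))) ->
    (forall h, exists g : 'M[R]_(1 + d), [/\ g^T *m g = 1%:M, \det g = 1 &
      forall w, herm (g *m w) = val (rho h) *m herm w *m adjmx S (val (rho h))]) ->
  homeomorphic (polygon_space R (1 + d) k) (rorbits (induced_raction lrC)).
Proof.
move=> lift proj.
apply: (homeomorphic_quotients (phi := stiefel_polygon)
  (quotient_map_comp (quotient_map_lorbit l) (quotient_map_rorbit (induced_raction lrC)))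
  (quotient_map_lorbit _) stiefel_polygon_continuous _ stiefel_polygon_section).
move=> X Y /=; split.
  move=> /(proj1 (@rorbitP _ _ (induced_raction lrC) (lorbit l X) (lorbit l Y)))[c].
  rewrite /= (induced_ractE lrC) => /(proj1 (@lorbitP _ _ _ _ _))[h XY].
  have [g [g1 detg gh]] := proj h; have [g' g'E] := special_orthogonal_exists g1 detg.
  apply/lorbitP; exists g'; apply: val_inj; rewrite SubK /= [val (val g')]g'E.
  rewrite -(polygon_of_mul _ (unitaryP (rho h)) gh) -[sval X]/(val X) -lE.
  (* Here Y = h X c, and the right factor c does not affect the polygon. *)
  rewrite -XY -lrC -[RHS]val_stiefel_polygon -val_stiefel_polygon; congr val.
  by apply/stiefel_polygon_fiber; exists c.
move=> /lorbitP[g /(congr1 val)]; rewrite SubK !val_stiefel_polygon => gXY.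
have [g1 detg] := special_orthogonalP g; have [h hg] := lift _ g1 detg.
(* Once g is lifted to h, the matrices h X and Y have the same polygon, hence differ by unit factors
   on the columns. *)
have /stiefel_polygon_fiber[c cE] : stiefel_polygon (l h X) = stiefel_polygon Y.
  apply: val_inj; rewrite !val_stiefel_polygon lE.
  by rewrite (polygon_of_mul _ (unitaryP (rho h)) hg).
apply/(@rorbitP _ _ (induced_raction lrC)); exists c; rewrite /= (induced_ractE lrC); apply/lorbitP.
by exists h; rewrite -lrC.
Qed.
End StiefelPolygon.

(** * The real and complex numbers *)

Section ComplexTopology.
Variable R : realType.
Implicit Types z w : R[i].

Lemma ball_complexE z (e : R) w : ball z e%:C%C w <->
  Num.sqrt (complex.Re (z - w) ^+ 2 + complex.Im (z - w) ^+ 2) < e.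
Proof.
have -> : ball z e%:C%C w = (`|z - w| < e%:C%C) :> Prop by [].
by rewrite normc_def ltcR.
Qed.

Lemma complex_Re_continuous : continuous (@complex.Re R : R[i] -> R).
Proof.
move=> z A /nbhs_ballP[e /= e0 sA]; apply/nbhs_ballP.
exists e%:C%C => /=; first by rewrite ltcR.
move=> w /ball_complexE zw; apply: sA; rewrite -ball_normE /=.
apply: le_lt_trans zw; rewrite -raddfB -sqrtr_sqr ler_wsqrtr//.
by rewrite lerDl sqr_ge0.
Qed.

Lemma complex_Im_continuous : continuous (@complex.Im R : R[i] -> R).
Proof.
move=> z A /nbhs_ballP[e /= e0 sA]; apply/nbhs_ballP.
exists e%:C%C => /=; first by rewrite ltcR.
move=> w /ball_complexE zw; apply: sA; rewrite -ball_normE /=.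
apply: le_lt_trans zw; rewrite -raddfB -sqrtr_sqr ler_wsqrtr//.
by rewrite lerDr sqr_ge0.
Qed.

Lemma complex_continuous_at (X : topologicalType) (x : X) (f : X -> R[i]) :
  {for x, continuous (fun y => complex.Re (f y))} ->
  {for x, continuous (fun y => complex.Im (f y))} -> {for x, continuous f}.
Proof.
move=> fR fI A /nbhs_ballP[e /= e0 sA].
(* Radii of balls in R[i] lie in R[i]; a positive one is real. *)
have [er er0 ee] : exists2 er : R, 0 < er & e = er%:C%C.
  by case: (e) e0 => a b; rewrite ltcE /= => /andP[/eqP-> a0]; exists a.
have e2 : 0 < er / 2 by rewrite divr_gt0.
have nR : \forall y \near x, `|complex.Re (f x) - complex.Re (f y)| < er / 2.
  by move/cvgrPdist_lt: fR; apply.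
have nI : \forall y \near x, `|complex.Im (f x) - complex.Im (f y)| < er / 2.
  by move/cvgrPdist_lt: fI; apply.
suff : \forall y \near x, A (f y) by exact.
apply: filterS2 nR nI => y /= yR yI; apply: sA; rewrite ee.
apply/ball_complexE; rewrite !raddfB /=.
move: yR yI; set a := _ - _; set b := _ - complex.Im _ => a_lt b_lt.
move: a_lt b_lt; rewrite !ltr_norml => /andP[a1 a2] /andP[b1 b2].
(* Squares are compared: a^2 + b^2 < er^2 / 2. *)
rewrite -(ger0_norm (ltW er0)) -sqrtr_sqr ltr_sqrt ?exprn_gt0//.
by nra.
Qed.
End ComplexTopology.

Section RealInstance.
Variable R : realType.

Lemma real_coordK :
  cancel (fun x : R => x%:M : 'cV[R]_1) (fun v : 'cV[R]_1 => v ord0 ord0).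
Proof. by move=> x; rewrite mxE. Qed.

Lemma real_coord_invK :
  cancel (fun v : 'cV[R]_1 => v ord0 ord0) (fun x : R => x%:M : 'cV[R]_1).
Proof. by move=> v; exact/esym/mx11_scalar. Qed.

Lemma real_mul_cj (x : R) :
  x * cj (real_conj_norm R) x = dot (x%:M : 'cV[R]_1) x%:M.
Proof. by rewrite dotE big_ord1 mxE. Qed.

Lemma real_mul_continuous : continuous (fun p : R * R => p.1 * p.2).
Proof. by move=> p; apply: cvgM; [exact: cvg_fst|exact: cvg_snd]. Qed.

Lemma real_coord_continuous : continuous (fun x : R => x%:M : 'cV[R]_1).
Proof.
move=> x; suff h : {for x, continuous (fun x : R => x%:M : 'cV[R]_1)} by exact: h.
apply: mx_continuous_at => i j; apply: (eq_continuous_at (f := id)).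
  by move=> y; rewrite mxE !ord1.
exact: cvg_id.
Qed.

Lemma real_id_continuous : continuous (@id R).
Proof. by move=> x; exact: cvg_id. Qed.

Definition real_coords : real_coordinates (real_conj_norm R) 1 :=
  @RealCoordinates R R (real_conj_norm R) 1 idfun (fun x => x%:M)
    (fun v : 'cV[R]_1 => v ord0 ord0) (fun a x => mulrC a x) (fun a => erefl) real_coordK
    real_coord_invK (fun x y => raddfD _ x y)
    (fun a x => esym (scale_scalar_mx 1 a x)) real_mul_cj real_mul_continuous
    real_id_continuous real_id_continuous real_coord_continuous
    (@entry_continuous _ _ _ _ _).
End RealInstance.

Section ComplexInstance.
Variable R : realType.
Local Notation S := (complex_conj_norm R).

Definition complex_coord (z : R[i]) : 'cV[R]_2 :=
  \col_i if i == ord0 then complex.Re z else complex.Im z.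
Definition complex_coord_inv (v : 'cV[R]_2) : R[i] :=
  (v ord0 ord0 +i* v ord_max ord0)%C.

Lemma complex_coordK : cancel complex_coord complex_coord_inv.
Proof. by move=> [a b]; rewrite /complex_coord_inv !mxE. Qed.

Lemma complex_coord_invK : cancel complex_coord_inv complex_coord.
Proof. by move=> v; apply/matrixP => i j; rewrite (ord1 j) mxE; move: i; elim/ord2P. Qed.

Lemma complex_coordD : {morph complex_coord : x y / x + y}.
Proof. by move=> x y; apply/matrixP => i j; rewrite !mxE !raddfD; case: ifP. Qed.

Lemma complex_coord_emb (a : R) x : complex_coord (a%:C%C * x) = a *: complex_coord x.
Proof.
case: x => u v; apply/matrixP => i j; rewrite !mxE /=.
by case: ifP => _; ring.
Qed.

Lemma complex_mul_cj x : x * cj S x = (dot (complex_coord x) (complex_coord x))%:C%C.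
Proof.
case: x => u v; rewrite dotE big_ord_recl big_ord1 !mxE /=.
by apply/eqP; rewrite eq_complex /=; apply/andP; split; apply/eqP; ring.
Qed.

Lemma complex_mul_continuous : continuous (fun p : R[i] * R[i] => p.1 * p.2).
Proof.
move=> p; suff h : {for p, continuous (fun p : R[i] * R[i] => p.1 * p.2)} by exact: h.
have c1 : {for p, continuous (fun p : R[i] * R[i] => complex.Re p.1)}.
  exact: continuous_at_comp (@cvg_fst _ _ _ _ _) (@complex_Re_continuous R).
have c2 : {for p, continuous (fun p : R[i] * R[i] => complex.Re p.2)}.
  exact: continuous_at_comp (@cvg_snd _ _ _ _ _) (@complex_Re_continuous R).
have c3 : {for p, continuous (fun p : R[i] * R[i] => complex.Im p.1)}.
  exact: continuous_at_comp (@cvg_fst _ _ _ _ _) (@complex_Im_continuous R).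
have c4 : {for p, continuous (fun p : R[i] * R[i] => complex.Im p.2)}.
  exact: continuous_at_comp (@cvg_snd _ _ _ _ _) (@complex_Im_continuous R).
apply: complex_continuous_at.
  apply: (eq_continuous_at (f := fun p =>
    complex.Re p.1 * complex.Re p.2 - complex.Im p.1 * complex.Im p.2)).
    by move=> [[? ?] [? ?]].
  by apply: cvgB; apply: cvgM.
apply: (eq_continuous_at (f := fun p =>
    complex.Re p.1 * complex.Im p.2 + complex.Im p.1 * complex.Re p.2)).
  by move=> [[? ?] [? ?]].
by apply: cvgD; apply: cvgM.
Qed.

Lemma complex_cj_continuous : continuous (cj S : R[i] -> R[i]).
Proof.
move=> z; suff h : {for z, continuous (cj S : R[i] -> R[i])} by exact: h.
apply: complex_continuous_at.
  apply: (eq_continuous_at (f := @complex.Re R)); first by case.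
  exact: complex_Re_continuous.
apply: (eq_continuous_at (f := fun z : R[i] => - complex.Im z)); first by case.
by apply: continuousN; exact: complex_Im_continuous.
Qed.

Lemma complex_emb_continuous : continuous (real_complex R : R -> R[i]).
Proof.
move=> x; suff h : {for x, continuous (real_complex R : R -> R[i])} by exact: h.
by apply: complex_continuous_at; [exact: cvg_id|exact: cvg_cst].
Qed.

Lemma complex_coord_continuous : continuous (complex_coord : R[i] -> 'cV[R]_2).
Proof.
move=> z; suff h : {for z, continuous complex_coord} by exact: h.
apply: mx_continuous_at => i j.
apply: (eq_continuous_at (f := fun z => if i == ord0 then complex.Re z else complex.Im z)).
  by move=> w; rewrite mxE.
by case: (i == ord0); [exact: complex_Re_continuous|exact: complex_Im_continuous].
Qed.

Lemma complex_coord_inv_continuous : continuous (complex_coord_inv : 'cV[R]_2 -> R[i]).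
Proof.
move=> v; suff h : {for v, continuous complex_coord_inv} by exact: h.
by apply: complex_continuous_at; exact: entry_continuous.
Qed.

Definition complex_coords : real_coordinates S 2 :=
  @RealCoordinates R R[i] S 2 (real_complex R) complex_coord complex_coord_inv
    (fun a x => mulrC _ _) (@conjc_real R) complex_coordK complex_coord_invK
    complex_coordD complex_coord_emb complex_mul_cj complex_mul_continuous
    complex_cj_continuous complex_emb_continuous complex_coord_continuous
    complex_coord_inv_continuous.
End ComplexInstance.

(** * Orientation *)

Section Anticommute.
Variables (R : realType) (F : topNzRingType) (S : conj_norm R F) (d : nat).
Variable C : real_coordinates S d.

(** The element 2 is invertible in F because F contains the reals. *)
Lemma self_opp_eq0 (x : F) : x = - x -> x = 0.
Proof.
move=> xN; have xx : x + x = 0 by rewrite {1}xN addNr.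
have -> : x = emb C 2^-1 * (x + x).
  rewrite mulrDr -mulrDl -rmorphD (_ : 2^-1 + 2^-1 = 1 :> R); last by field.
  by rewrite rmorph1 mul1r.
by rewrite xx mulr0.
Qed.

Lemma herm_anticommute (D : 'M[F]_2) :
    (forall w, D *m herm C w = - (herm C w *m D)) ->
  exists2 p, D = mx2 0 p (- p) 0 & forall x, p * cj S x = x * p.
Proof.
rewrite (mx2E D); set a := D _ _; set p := D _ _; set q := D _ _; set e := D _ _.
move=> aD.
(* Anticommuting with diag(1, -1) makes the diagonal of D vanish. *)
have := aD (pack C 1 0).
rewrite herm_pack rmorph1 cj0 !mx2M mx2N => E; have [] := mx2_inj E.
rewrite !(mulr0, mul0r, addr0, add0r, mulrN, mulNr, mulr1, mul1r, opprK).
move=> /self_opp_eq0 a0 _ _ /esym/self_opp_eq0 e0.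
(* The off-diagonal Hermitian matrices are tested next; x = 1 then gives q = -p. *)
have off x : p * cj S x = - (x * q).
  have := aD (pack C 0 x); rewrite herm_pack rmorph0 !mx2M mx2N => E'; have [+ _ _ _] := mx2_inj E'.
  by rewrite a0 !(mulr0, mul0r, addr0, add0r).
have pq : q = - p by have := off 1; rewrite cj1 mulr1 mul1r => ->; rewrite opprK.
exists p; first by rewrite a0 e0 pq.
by move=> x; rewrite off pq mulrN opprK.
Qed.
End Anticommute.

(** Determinants are taken over commutative rings, so R and C get their own structure for SO(2) and
    SU(2). *)
#[short(type="topComNzRingType")]
HB.structure Definition TopComNzRing := {F of Topological F & GRing.ComNzRing F}.

HB.instance Definition _ (R : realType) := GRing.ComNzRing.on (Real.sort R).
HB.instance Definition _ (R : realType) := GRing.ComNzRing.on R[i].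

(** * Determinant one: the groups SO(2) and SU(2) *)

Section CommutativeCase.
Variables (R : realType) (F : topComNzRingType) (S : conj_norm R F) (d k : nat).
Variable C : real_coordinates S d.

Lemma det_mx2 (a b c e : F) : \det (mx2 a b c e) = a * e - b * c.
Proof.
rewrite (expand_det_row _ ord0) big_ord_recl big_ord1 /cofactor !det_mx11 !mxE /=.
by rewrite expr0 mul1r expr1 mulN1r mulrN.
Qed.

(** A unit vector with head t and tail x has determinant -(t^2 + |x|^2) = -1. *)
Lemma det_pin us : unit_vectors us -> \det (pin C us) = (-1) ^+ size us.
Proof.
elim: us => [_|u us IHus] /=; first by rewrite det1.
move=> /andP[/eqP u1 /IHus us1]; rewrite det_mulmx us1 exprS; congr (_ * _).
rewrite det_mx2 (mulcj C) mulrN -rmorphM -opprD -rmorphD -expr2.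
by rewrite -dot_head_tail u1 rmorph1.
Qed.

(** For a product P of an odd number of unit vectors, det(A^* P) = -1, whereas an anticommuting
    matrix with rows (0, p) and (-p, 0) has determinant p^2. The hypothesis on p thus excludes a
    reversal of orientation. *)
Lemma special_polygon_homeomorphic :
    (forall p : F, (forall x, p * cj S x = x * p) -> p * p != -1) ->
  homeomorphic (polygon_space R (1 + d) k)
    (rorbits (induced_raction
      (l := restr_laction (special_incl S 2) (stiefel_laction S k))
      (r := stiefel_raction S k) (fun g X c => stiefel_actC (val g) X c))).
Proof.
move=> noD.
refine (@polygon_space_homeomorphic R F S d C k (special_unitary S 2)
  (restr_laction (special_incl S 2) (stiefel_laction S k)) (fun h => val h) _ _ _ _).
- by move=> h X; rewrite SubK.
- move=> g g1 detg; have [us [us1 us_even gE]] := spin_lift C g1 detg.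
  have A_mem : pin C us \in unitary_set S 2 by exact/mem_set/pin_unitary.
  have A_sp : special (Sub (pin C us) A_mem : unitary S 2).
    by rewrite /special SubK det_pin// -signr_odd (negbTE us_even).
  by exists (Sub _ A_sp) => w; rewrite gE !SubK.
- move=> h; apply: conj_special; first exact: unitaryP.
  move=> us us1 us_odd /herm_anticommute[p DE /noD/eqP]; apply.
  have [_ /(congr1 determinant)] := unitaryP (val h).
  rewrite det_mulmx det1 (eqP (valP h)) mulr1 => detA.
  have := congr1 determinant DE; rewrite det_mulmx detA det_pin// det_mx2.
  by rewrite -signr_odd us_odd mul1r mul0r sub0r mulrN opprK => <-.
Qed.
End CommutativeCase.

(** * The quaternions *)

Section QuaternionInstance.
Variable R : realType.
Local Notation S := (quaternion_conj_norm R).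
Local Notation H := (quaternion R).

Definition quat_re (x : H) : R := x.1.1.1.
Definition quat_i (x : H) : R := x.1.1.2.
Definition quat_j (x : H) : R := x.1.2.
Definition quat_k (x : H) : R := x.2.

Definition quat_emb (a : R) : H := (a, 0, 0, 0).

Lemma quat_emb_zmod : zmod_morphism quat_emb.
Proof. by move=> a b; rewrite [RHS]/GRing.add /=; congr (_, _, _, _); ring. Qed.

Lemma quat_emb_monoid : monoid_morphism quat_emb.
Proof.
split=> // a b; rewrite [RHS]/GRing.mul /=; congr (_, _, _, _); ring.
Qed.

HB.instance Definition _ := GRing.isZmodMorphism.Build R H quat_emb quat_emb_zmod.
HB.instance Definition _ := GRing.isMonoidMorphism.Build R H quat_emb quat_emb_monoid.

Lemma quat_emb_comm a (x : H) : quat_emb a * x = x * quat_emb a.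
Proof. by case: x => [[[? ?] ?] ?]; rewrite /GRing.mul /=; congr (_, _, _, _); ring. Qed.

Lemma quat_cj_emb a : cj S (quat_emb a) = quat_emb a.
Proof. by rewrite /= !oppr0. Qed.

Definition quat_coord (x : H) : 'cV[R]_4 :=
  \col_i [:: quat_re x; quat_i x; quat_j x; quat_k x]`_i.
Definition quat_coord_inv (v : 'cV[R]_4) : H :=
  (v (inord 0) ord0, v (inord 1) ord0, v (inord 2) ord0, v (inord 3) ord0).

Lemma quat_coordK : cancel quat_coord quat_coord_inv.
Proof. by move=> [[[a b] c] d]; rewrite /quat_coord_inv !mxE !inordK. Qed.

Lemma quat_coord_invK : cancel quat_coord_inv quat_coord.
Proof.
move=> v; apply/matrixP => i j; rewrite (ord1 j) mxE.
by case: i => [[|[|[|[|//]]]] lti] /=; congr (v _ _); apply: val_inj; rewrite /= inordK.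
Qed.

Lemma quat_coordD : {morph quat_coord : x y / x + y}.
Proof.
move=> x y; apply/matrixP => i j; rewrite !mxE.
by case: i => [[|[|[|[|//]]]] lti].
Qed.

Lemma quat_coord_emb a x : quat_coord (quat_emb a * x) = a *: quat_coord x.
Proof.
case: x => [[[b c] d] e].
have -> : quat_emb a * ((b, c, d, e) : H) = (a * b, a * c, a * d, a * e).
  by rewrite [LHS]/GRing.mul /=; congr (_, _, _, _); ring.
by apply/matrixP => i j; rewrite !mxE; case: i => [[|[|[|[|//]]]] lti].
Qed.

Lemma quat_mul_cj x : x * cj S x = quat_emb (dot (quat_coord x) (quat_coord x)).
Proof.
case: x => [[[b c] d] e]; rewrite dotE !big_ord_recl big_ord0 !mxE.
rewrite [LHS]/GRing.mul /= /quat_emb /quat_re /quat_i /quat_j /quat_k /=.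
by congr (_, _, _, _); ring.
Qed.

Section ContinuousAt.
Variables (X : topologicalType) (x : X).

Lemma quat_continuous_at (f : X -> H) :
  {for x, continuous (fun y => quat_re (f y))} ->
  {for x, continuous (fun y => quat_i (f y))} ->
  {for x, continuous (fun y => quat_j (f y))} ->
  {for x, continuous (fun y => quat_k (f y))} -> {for x, continuous f}.
Proof.
move=> f1 f2 f3 f4.
apply: (eq_continuous_at
  (f := fun y => (quat_re (f y), quat_i (f y), quat_j (f y), quat_k (f y)) : H)).
  by move=> y; case: (f y) => [[[? ?] ?] ?].
exact: (cvg_pair (cvg_pair (cvg_pair f1 f2) f3) f4).
Qed.
End ContinuousAt.

Lemma quat_re_continuous : continuous quat_re.
Proof.
move=> x; suff h : {for x, continuous quat_re} by exact: h.
by apply: (@continuous_at_comp _ _ (R * R)%type _ (fun x : H => x.1.1) fst);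
  [apply: (@continuous_at_comp _ _ (R * R * R)%type _ (fun x : H => x.1) fst)|];
  by move=> *; exact: cvg_fst.
Qed.

Lemma quat_i_continuous : continuous quat_i.
Proof.
move=> x; suff h : {for x, continuous quat_i} by exact: h.
apply: (@continuous_at_comp _ _ (R * R)%type _ (fun x : H => x.1.1) snd).
  by apply: (@continuous_at_comp _ _ (R * R * R)%type _ (fun x : H => x.1) fst);
    move=> *; exact: cvg_fst.
by move=> *; exact: cvg_snd.
Qed.

Lemma quat_j_continuous : continuous quat_j.
Proof.
move=> x; suff h : {for x, continuous quat_j} by exact: h.
apply: (@continuous_at_comp _ _ (R * R * R)%type _ (fun x : H => x.1) snd).
  exact: cvg_fst.
by move=> *; exact: cvg_snd.
Qed.

Lemma quat_k_continuous : continuous quat_k.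
Proof. by move=> x; exact: cvg_snd. Qed.

Lemma quat_mul_continuous : continuous (fun p : H * H => p.1 * p.2).
Proof.
move=> p; suff h : {for p, continuous (fun p : H * H => p.1 * p.2)} by exact: h.
have fstc g : continuous g -> {for p, continuous (fun p : H * H => g p.1 : R)}.
  by move=> gc; exact: continuous_at_comp (@cvg_fst _ _ _ _ _) gc.
have sndc g : continuous g -> {for p, continuous (fun p : H * H => g p.2 : R)}.
  by move=> gc; exact: continuous_at_comp (@cvg_snd _ _ _ _ _) gc.
have [a1 a2] := (fstc _ quat_re_continuous, sndc _ quat_re_continuous).
have [b1 b2] := (fstc _ quat_i_continuous, sndc _ quat_i_continuous).
have [c1 c2] := (fstc _ quat_j_continuous, sndc _ quat_j_continuous).
have [d1 d2] := (fstc _ quat_k_continuous, sndc _ quat_k_continuous).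
apply: quat_continuous_at.
- apply: (eq_continuous_at (f := fun p : H * H => quat_re p.1 * quat_re p.2 -
    quat_i p.1 * quat_i p.2 - quat_j p.1 * quat_j p.2 - quat_k p.1 * quat_k p.2)).
    by move=> [[[[? ?] ?] ?] [[[? ?] ?] ?]].
  by apply: cvgB; [apply: cvgB; [apply: cvgB|]|]; apply: cvgM.
- apply: (eq_continuous_at (f := fun p : H * H => quat_re p.1 * quat_i p.2 +
    quat_i p.1 * quat_re p.2 + quat_j p.1 * quat_k p.2 - quat_k p.1 * quat_j p.2)).
    by move=> [[[[? ?] ?] ?] [[[? ?] ?] ?]].
  by apply: cvgB; [apply: cvgD; [apply: cvgD|]|]; apply: cvgM.
- apply: (eq_continuous_at (f := fun p : H * H => quat_re p.1 * quat_j p.2 -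
    quat_i p.1 * quat_k p.2 + quat_j p.1 * quat_re p.2 + quat_k p.1 * quat_i p.2)).
    by move=> [[[[? ?] ?] ?] [[[? ?] ?] ?]].
  by apply: cvgD; [apply: cvgD; [apply: cvgB|]|]; apply: cvgM.
- apply: (eq_continuous_at (f := fun p : H * H => quat_re p.1 * quat_k p.2 +
    quat_i p.1 * quat_j p.2 - quat_j p.1 * quat_i p.2 + quat_k p.1 * quat_re p.2)).
    by move=> [[[[? ?] ?] ?] [[[? ?] ?] ?]].
  by apply: cvgD; [apply: cvgB; [apply: cvgD|]|]; apply: cvgM.
Qed.

Lemma quat_conj_continuous : continuous (cj S : H -> H).
Proof.
move=> x; suff h : {for x, continuous (cj S : H -> H)} by exact: h.
apply: quat_continuous_at.
- apply: (eq_continuous_at (f := quat_re)); first by move=> [[[? ?] ?] ?].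
  exact: quat_re_continuous.
- apply: (eq_continuous_at (f := fun y => - quat_i y)); first by move=> [[[? ?] ?] ?].
  by apply: continuousN; exact: quat_i_continuous.
- apply: (eq_continuous_at (f := fun y => - quat_j y)); first by move=> [[[? ?] ?] ?].
  by apply: continuousN; exact: quat_j_continuous.
- apply: (eq_continuous_at (f := fun y => - quat_k y)); first by move=> [[[? ?] ?] ?].
  by apply: continuousN; exact: quat_k_continuous.
Qed.

Lemma quat_emb_continuous : continuous quat_emb.
Proof.
move=> x; suff h : {for x, continuous quat_emb} by exact: h.
by apply: quat_continuous_at; [exact: cvg_id|exact: cvg_cst..].
Qed.

Lemma quat_coord_continuous : continuous quat_coord.
Proof.
move=> x; suff h : {for x, continuous quat_coord} by exact: h.
apply: mx_continuous_at => i j.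
apply: (eq_continuous_at (f := fun y => [:: quat_re y; quat_i y; quat_j y; quat_k y]`_i)).
  by move=> y; rewrite mxE.
case: i => [[|[|[|[|//]]]] lti] /=.
- exact: quat_re_continuous.
- exact: quat_i_continuous.
- exact: quat_j_continuous.
- exact: quat_k_continuous.
Qed.

Lemma quat_coord_inv_continuous : continuous quat_coord_inv.
Proof.
move=> x; suff h : {for x, continuous quat_coord_inv} by exact: h.
by apply: quat_continuous_at; exact: entry_continuous.
Qed.

Definition quat_coords : real_coordinates S 4 :=
  @RealCoordinates R H S 4 quat_emb quat_coord quat_coord_inv
    quat_emb_comm quat_cj_emb quat_coordK quat_coord_invK
    quat_coordD quat_coord_emb quat_mul_cj quat_mul_continuous
    quat_conj_continuous quat_emb_continuous quat_coord_continuous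
    quat_coord_inv_continuous.

(** For x = i, j, k the condition says that p anticommutes with x, which kills the real component of
    p and its component along x. *)
Lemma quat_twisted_center (p : H) : (forall x, p * cj S x = x * p) -> p = 0.
Proof.
case: p => [[[a b] c] d] tw.
have := tw (0, 1, 0, 0); have := tw (0, 0, 1, 0); have := tw (0, 0, 0, 1).
rewrite /GRing.mul /= => -[k1 _ _ k4] [j1 _ j3 _] [i1 i2 _ _].
by congr (_, _, _, _); lra.
Qed.
End QuaternionInstance.

Theorem theorem31 (R : realType) (k : nat) (hk : (3 <= k)%N) :
  [/\ homeomorphic (polygon_space R 2 k) (oriented_Gr_mod_O1 R k),
      homeomorphic (polygon_space R 3 k) (SU2_stiefel_mod_U1 R k) &
      homeomorphic (polygon_space R 5 k) (quaternionic_Gr_mod_H1 R k)].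
Proof.
(* The dimensions 2, 3, 5 are 1 + d for d = 1, 2, 4. *)
split.
- apply: (special_polygon_homeomorphic k (real_coords R)) => p _.
  by have := sqr_ge0 p; rewrite expr2 => p0; apply/eqP => pp; lra.
- apply: (special_polygon_homeomorphic k (complex_coords R)) => p tw.
  suff -> : p = 0 by rewrite mul0r eq_sym oppr_eq0 oner_eq0.
  (* Taking x = i gives - p i = i p, whence p = 0. *)
  have := tw 'i%C; case: (p) => a b /= [e1 e2].
  by apply/eqP; rewrite eq_complex /=; apply/andP; split; apply/eqP; lra.
- refine (@polygon_space_homeomorphic R (quaternion R) (quaternion_conj_norm R) 4
    (quat_coords R) k _ (stiefel_laction (quaternion_conj_norm R) k) id _ _ _ _).
  + by move=> h X; rewrite SubK.
  + move=> g g1 detg; have [us [us1 _ gE]] := spin_lift (quat_coords R) g1 detg.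
    have A_mem : pin (quat_coords R) us \in unitary_set (quaternion_conj_norm R) 2.
      exact/mem_set/pin_unitary.
    by exists (Sub (pin (quat_coords R) us) A_mem : unitary (quaternion_conj_norm R) 2) => w;
      rewrite gE !SubK.
  + move=> h; apply: conj_special; first exact: unitaryP.
    move=> us us1 _ /herm_anticommute[p DE /quat_twisted_center p0].
    have [h1 _] := unitaryP h; have [P1 _] := pin_unitary (quat_coords R) us1.
    (* Writing A for [val h] and P for the product, p = 0 gives A^* P = 0, although A (A^* P) P^* =
       I. *)
    have := congr1 (fun M => val h *m M *m
      adjmx (quaternion_conj_norm R) (pin (quat_coords R) us)) DE.
    rewrite mulmxA h1 mul1mx P1 p0 oppr0 -scalar_mx2 raddf0 mulmx0 mul0mx.
    by move=> /matrixP/(_ ord0 ord0); rewrite !mxE => /eqP; rewrite oner_eq0.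
Qed.
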